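(* Let $X=(X(t))_{t\ge0}$ be a fractional Brownian motion with Hurst parameter $H=1/6$, and let $T>0$. For $\varepsilon>0$ let $$[X,3]_\varepsilon(T):=\frac1\varepsilon\int_0^T\left(X(s+\varepsilon)-X(s)\right)^3ds.$$ Then $[X,3]_\varepsilon(T)$ has no limit in $L^2(\Omega)$ as $\varepsilon\to0$; in fact, $[X,3]_\varepsilon(T)$ has no limit in probability as $\varepsilon\to0$.
   Context: Fractional Brownian motion with Hurst parameter $H$ is the centered continuous Gaussian process with $X(0)=0$ and $\mathbf{E}[(X(t)-X(s))^2]=|t-s|^{2H}$. *)

(* Defs.v *)
From HB Require Import structures.
From mathcomp Require Export all_boot all_order all_algebra.
From mathcomp Require Export all_classical all_reals all_analysis.
Set Implicit Arguments.
Unset Strict Implicit.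
Unset Printing Implicit Defensive.
Import Order.TTheory GRing.Theory Num.Theory.
Import numFieldNormedType.Exports.
Local Open Scope classical_set_scope.
Local Open Scope ring_scope.

(* The case s = 0 is split off because [normal_prob m 0] is by convention the
   uniform law on [0, 1] instead of the point mass at m. *)
Definition gaussian_law (R : realType) (m s : R) (A : set R) : \bar R :=
  if s == 0 then \d_m A else normal_prob m s A.

Definition gaussian_rv (d : measure_display) (Omega : measurableType d)
    (R : realType) (P : probability Omega R) (Y : Omega -> R) : Prop :=
  exists m s : R, 0 <= s /\
    forall A : set R, measurable A -> P (Y @^-1` A) = gaussian_law m s A.

(* Processes are indexed by t >= 0: the values at t < 0 of a family
   [X : R -> {RV P >-> R}] are never constrained nor used. *)
Definition gaussian_process (d : measure_display) (Omega : measurableType d)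
    (R : realType) (P : probability Omega R) (X : R -> {RV P >-> R}) : Prop :=
  forall (n : nat) (t a : 'I_n -> R), (forall i, 0 <= t i) ->
    gaussian_rv P (fun w => \sum_(i < n) a i * X (t i) w).

Record fractional_brownian_motion (d : measure_display)
    (Omega : measurableType d) (R : realType) (P : probability Omega R)
    (H : R) (X : R -> {RV P >-> R}) : Prop := {
  fbm_gaussian : gaussian_process X ;
  fbm_centered : forall t : R, 0 <= t -> ('E_P[X t] = 0)%E ;
  fbm_continuous :
    forall w : Omega, {within `[0, +oo[, continuous (fun t : R => X t w)} ;
  fbm_start : forall w : Omega, X 0 w = 0 ;
  fbm_increments : forall s t : R, 0 <= s -> 0 <= t ->
    ('E_P[(fun w => (X t w - X s w) ^+ 2)%R] =
       (`|t - s| `^ (2 * H))%R%:E)%E }.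

(* [X, 3]_eps(T). The integral is the Lebesgue integral of each path, finite
   because paths are continuous. *)
Definition cubic_variation (d : measure_display) (Omega : measurableType d)
    (R : realType) (P : probability Omega R) (X : R -> {RV P >-> R})
    (T eps : R) (w : Omega) : R :=
  eps^-1 * \int[lebesgue_measure]_(s in `[0, T]) (X (s + eps) w - X s w) ^+ 3.

Definition cvg_L2_at0 (d : measure_display) (Omega : measurableType d)
    (R : realType) (P : probability Omega R) (Z : R -> Omega -> R)
    (Y : Omega -> R) : Prop :=
  'N[P]_2%:E [EFin \o (Z eps \- Y)%R]%E @[eps --> 0^'+] --> 0%E.

Definition cvg_probability_at0 (d : measure_display)
    (Omega : measurableType d) (R : realType) (P : probability Omega R)
    (Z : R -> Omega -> R) (Y : Omega -> R) : Prop :=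
  forall delta : R, 0 < delta ->
    P [set w | delta <= `|Z eps w - Y w|] @[eps --> 0^'+] --> 0%E.

(* Main.v *)
(** At scale e = T/N the variable Z_e = [X, 3]_e(T) is a limit of Riemann sums
    of cubes of increments of length e. For H = 1/6 the covariances of these
    increments make E[Z_e ^ 2] bounded, but the part of Z_e in the third chaos
    does not vanish and is asymptotically uncorrelated with everything seen at
    coarser scales. To exhibit this with exponential moments only, we test Z_e
    against G_e = e^(1/2) times a sum over j of second differences of
    exp(- Var B / 2) sinh B, where B runs over combinations of normalized
    increments of length e located near j e. Differentiating the
    moment-generating function gives E[A^3 e^B] for Gaussian A, B, whence
    E[Z_e G_e] >= theta T, by a sum of the kernel [ker3 * ker1 ^ 2] over the
    lattice. The fourth moment of G_e is bounded because the fourth moment of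
    normalized hyperbolic sines only involves graphs on four vertices with all
    degrees odd. For e fixed, E[Z_h G_e] -> 0 as h -> 0.

    If Z_e -> Y in probability, then D = Z_e - Z_h is small in probability for
    small e and much smaller h. But E[D G_e] >= c, E[D ^ 2] <= A and
    E[G_e ^ 4] <= C force P(|D| >= eta) to be bounded below. Convergence in L^2
    implies convergence in probability by Chebyshev's inequality. *)

Require Import Defs.
From mathcomp Require Import all_boot all_order all_algebra.
From mathcomp Require Import all_classical all_reals all_analysis.
From mathcomp Require Import measurable_realfun ring lra.
Set Implicit Arguments.
Unset Strict Implicit.
Unset Printing Implicit Defensive.
Import Order.TTheory GRing.Theory Num.Theory.
Import numFieldNormedType.Exports.
Local Open Scope classical_set_scope.
Local Open Scope ring_scope.

(** * The cube root and its differences *)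

(** The obstacle is the sign of E[Z_e G_e]. For H = 1/6 disjoint increments are negatively
    correlated, and the correlations of one increment with all those of a lattice sum to zero, so a
    short B would meet contributions of both signs. A block of 2 L consecutive increments has
    positive covariance with an increment well inside it. Negative covariances occur only near or
    beyond its ends, where the covariance with the three middle increments is small and enters
    squared. This is why the kernel has a long factor and a short squared one, and why L is large.
    The nodes of the integral fall between those of the lattice, so the lower bound has to hold for
    every offset in [0, 1). All moments are computed for Riemann sums, with bounds independent of
    the number of offsets; the integral is recovered along each path, hence in probability. *)

Section cube_root.
Context (R : realType).
Implicit Types x y h u : R.

(* E[(X t - X s) ^ 2] = rt3 (t - s), since 2 H = 1 / 3. *)
Definition rt3 x : R := `|x| `^ 3^-1.

Lemma rt3_ge0 x : 0 <= rt3 x. Proof. exact: powR_ge0. Qed.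

Lemma rt3_cube x : rt3 x ^+ 3 = `|x|.
Proof.
rewrite -powR_mulrn ?rt3_ge0 // /rt3 -powRrM.
by rewrite mulVf ?pnatr_eq0 // powRr1.
Qed.

Lemma rt3N x : rt3 (- x) = rt3 x. Proof. by rewrite /rt3 normrN. Qed.

Lemma rt3M x y : rt3 (x * y) = rt3 x * rt3 y.
Proof. by rewrite /rt3 normrM powRM. Qed.

Lemma rt31 : rt3 1 = 1.
Proof. by rewrite /rt3 normr1 powR1. Qed.

Lemma ler_rt3 x y : `|x| <= `|y| -> rt3 x <= rt3 y.
Proof. by move=> xy; rewrite /rt3 ge0_ler_powR ?nnegrE ?invr_ge0. Qed.

Lemma rt3_ler x y : 0 <= y -> `|x| <= y ^+ 3 -> rt3 x <= y.
Proof.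
move=> y0; rewrite -rt3_cube => h.
by rewrite -(ler_pXn2r (n := 3)) ?nnegrE ?rt3_ge0.
Qed.

Lemma ler_rt3_r x y : 0 <= y -> y ^+ 3 <= `|x| -> y <= rt3 x.
Proof.
move=> y0; rewrite -rt3_cube => h.
by rewrite -(ler_pXn2r (n := 3)) ?nnegrE ?rt3_ge0.
Qed.

(** For a >= b >= 0 one has (a - b)^3 <= a^3 - b^3, the difference being 3 a b (a - b). *)
Lemma rt3_sub_le x y : `|rt3 x - rt3 y| <= rt3 (x - y).
Proof.
wlog xy : x y / rt3 y <= rt3 x.
  move=> hw; have /orP[h|h] := le_total (rt3 y) (rt3 x); first exact: hw.
  by rewrite distrC -[x - y]opprB rt3N; exact: hw.
rewrite ger0_norm ?subr_ge0 // ler_rt3_r ?subr_ge0 //.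
have h : rt3 x ^+ 3 - rt3 y ^+ 3 <= `|x - y|.
  rewrite !rt3_cube; have := ler_normD (x - y) y; rewrite subrK; lra.
have := rt3_ge0 y; move: h xy; move: (rt3 x) (rt3 y) => a b h ab b0.
apply: le_trans h; rewrite -subr_ge0.
rewrite (_ : _ - _ = 3 * (a * b * (a - b))); last by ring.
by rewrite !mulr_ge0 // ?subr_ge0 //; lra.
Qed.

Definition rtD x : R := rt3 (x + 1) - rt3 x.

(** Factoring a difference of cubes replaces calculus: on x >= 0 it makes [rtD] the reciprocal of a
    quadratic in cube roots, which yields both its monotonicity and its decay like x^(-2/3). *)
Lemma rtD_mul x : rtD x * (rt3 (x + 1) ^+ 2 + rt3 (x + 1) * rt3 x + rt3 x ^+ 2) = `|x + 1| - `|x|.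
Proof. by rewrite -!rt3_cube /rtD; ring. Qed.

Lemma rtD_mul1 x : 0 <= x ->
  rtD x * (rt3 (x + 1) ^+ 2 + rt3 (x + 1) * rt3 x + rt3 x ^+ 2) = 1.
Proof. by move=> x0; rewrite rtD_mul !ger0_norm //; lra. Qed.

(** [rt3] is even, so its unit difference is odd about -1/2. This decides the signs of [ker3] and
    [ker1]. *)
Lemma rtDN x : rtD (- 1 - x) = - rtD x.
Proof.
rewrite /rtD -(rt3N (-1 - x)) -(rt3N (-1 - x + 1)).
have -> : - (-1 - x + 1) = x by ring.
have -> : - (-1 - x) = x + 1 by ring.
by ring.
Qed.

Lemma rtD_ge0 x : 0 <= x -> 0 <= rtD x.
Proof.
move=> x0; rewrite subr_ge0 ler_rt3 // !ger0_norm //; lra.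
Qed.

Lemma rtD_le1 x : `|rtD x| <= 1.
Proof.
by rewrite /rtD (le_trans (rt3_sub_le _ _)) // addrAC subrr add0r rt31.
Qed.

Lemma rtD_mono x y : 0 <= x -> x <= y -> rtD y <= rtD x.
Proof.
move=> x0 xy.
have := rtD_mul1 x0; have := rtD_mul1 (le_trans x0 xy).
have h1 : rt3 x <= rt3 y by rewrite ler_rt3 // !ger0_norm //; lra.
have h2 : rt3 (x + 1) <= rt3 (y + 1) by rewrite ler_rt3 // !ger0_norm //; lra.
have h3 := rt3_ge0 x; have := rtD_ge0 x0; have := rtD_ge0 (le_trans x0 xy).
have h4 := rt3_ge0 (x + 1).
move: h1 h2 h3 h4; move: (rt3 x) (rt3 y) (rt3 (x + 1)) (rt3 (y + 1)) => a b a' b' h1 h2 h3 h4.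
move: (rtD x) (rtD y) => p q q0 p0 eq ep.
have hD : a' ^+ 2 + a' * a + a ^+ 2 <= b' ^+ 2 + b' * b + b ^+ 2.
  by rewrite !lerD // ?ler_pM // ler_pXn2r // nnegrE; lra.
have D0 : 0 <= a' ^+ 2 + a' * a + a ^+ 2 by rewrite !addr_ge0 ?mulr_ge0 ?exprn_ge0.
rewrite leNgt; apply/negP => pq.
have D1 : 0 < a' ^+ 2 + a' * a + a ^+ 2.
  rewrite lt_def D0 andbT; apply/eqP => e; move: ep; rewrite e mulr0 => /eqP.
  by rewrite eq_sym oner_eq0.
have : p * (a' ^+ 2 + a' * a + a ^+ 2) < q * (a' ^+ 2 + a' * a + a ^+ 2) by rewrite ltr_pM2r.
have : q * (a' ^+ 2 + a' * a + a ^+ 2) <= q * (b' ^+ 2 + b' * b + b ^+ 2) by rewrite ler_wpM2l.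
lra.
Qed.

Lemma rtD_ub x : 0 <= x -> 3 * rt3 x ^+ 2 * rtD x <= 1.
Proof.
move=> x0; have h : rt3 x <= rt3 (x + 1) by rewrite -subr_ge0 rtD_ge0.
have := rtD_mul1 x0; have := rtD_ge0 x0; have := rt3_ge0 x.
move: h; move: (rtD x) (rt3 x) (rt3 (x + 1)) => p b a h b0 p0 e.
have : 0 <= p * (a ^+ 2 + a * b - 2 * b ^+ 2) by rewrite mulr_ge0 //; nra.
lra.
Qed.

Lemma rtD_lb x : 0 <= x -> 1 <= 3 * rt3 (x + 1) ^+ 2 * rtD x.
Proof.
move=> x0; have h : rt3 x <= rt3 (x + 1) by rewrite -subr_ge0 rtD_ge0.
have := rtD_mul1 x0; have := rtD_ge0 x0; have := rt3_ge0 x.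
move: h; move: (rtD x) (rt3 x) (rt3 (x + 1)) => p b a h b0 p0 e.
have : 0 <= p * (2 * a ^+ 2 - a * b - b ^+ 2) by rewrite mulr_ge0 //; nra.
lra.
Qed.

Lemma sum_diff (phi : R -> R) x n :
  \sum_(i < n) (phi (x + i%:R + 1) - phi (x + i%:R)) = phi (x + n%:R) - phi x.
Proof.
elim: n => [|n ih]; first by rewrite big_ord0 addr0 subrr.
rewrite big_ord_recr /= ih.
have -> : x + n.+1%:R = x + n%:R + 1 by rewrite -addrA natr1.
by ring.
Qed.

Lemma sum_diff3 (phi : R -> R) (lo hi : R) x n : (forall y, lo <= phi y <= hi) ->
  \sum_(i < n) (phi (x + i%:R + 3) - phi (x + i%:R)) <= 3 * (hi - lo).
Proof.
move=> hphi.
rewrite (eq_bigr (fun i : 'I_n => (phi (x + i%:R + 1) - phi (x + i%:R)) +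
  (phi (x + 1 + i%:R + 1) - phi (x + 1 + i%:R)) +
  (phi (x + 2 + i%:R + 1) - phi (x + 2 + i%:R)))); last first.
  move=> i _; have -> : x + 2 + i%:R + 1 = x + i%:R + 3 by ring.
  have -> : x + 1 + i%:R + 1 = x + 2 + i%:R by ring.
  have -> : x + i%:R + 1 = x + 1 + i%:R by ring.
  by ring.
rewrite 2!big_split /= (sum_diff phi x) (sum_diff phi (x + 1)) (sum_diff phi (x + 2)).
have := hphi (x + n%:R); have := hphi x; have := hphi (x + 1 + n%:R).
have := hphi (x + 1); have := hphi (x + 2 + n%:R); have := hphi (x + 2); lra.
Qed.

(* For unit-spaced lags, rtD2 (x - y) / 2 is the correlation of the increments
   started at x e and y e. *)
Definition rtD2 x : R := rtD x - rtD (x - 1).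

Lemma rtD2E x : rtD2 x = rt3 (x + 1) + rt3 (x - 1) - 2 * rt3 x.
Proof. by rewrite /rtD2 /rtD subrK; ring. Qed.

Lemma rtD2N x : rtD2 (- x) = rtD2 x.
Proof.
rewrite !rtD2E rt3N -(rt3N (- x + 1)) -(rt3N (- x - 1)) !opprD !opprK.
by rewrite (addrC (rt3 (x - 1))).
Qed.

Lemma rtD2_le2 x : `|rtD2 x| <= 2.
Proof.
have := rtD_le1 x; have := rtD_le1 (x - 1).
by rewrite /rtD2 !ler_norml; lra.
Qed.

(* [rtD] decreases only on the half-line x >= 0; freezing it below x0 >= 0 makes
   it monotone everywhere, so that its variations telescope. *)
Definition cut x0 y : R := rtD (Num.max y x0).

Lemma cut_bnd x0 y : 0 <= x0 -> 0 <= cut x0 y <= rtD x0.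
Proof.
move=> h; rewrite /cut rtD_ge0 ?rtD_mono // ?le_max ?lexx ?h ?orbT //.
Qed.

Lemma cut_mono x0 y z : 0 <= x0 -> y <= z -> cut x0 z <= cut x0 y.
Proof.
move=> h yz; apply: rtD_mono; first by rewrite le_max h orbT.
by rewrite ge_max !le_max yz lexx !orbT.
Qed.

Lemma cutE x0 y : x0 <= y -> cut x0 y = rtD y.
Proof. by move=> h; rewrite /cut max_l. Qed.

(** On each side of (-1, 1), the absolute value of [rtD2] is a unit difference of a monotone
    function with oscillation at most 1, and telescopes. At most two lags fall inside (-1, 1), each
    costing at most 2; the step function [phi3] counts them. In all 1 + 1 + 4 = 6. *)
Lemma sum_rtD2 x n : \sum_(i < n) `|rtD2 (x + i%:R)| <= 6.
Proof.
pose chi y : R := if 0 <= y then 1 else 0.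
pose phi1 y := - cut 0 (y - 1).
pose phi2 y := cut 0 (- y).
pose phi3 y := 2 * chi y.
have pt y : `|rtD2 y| <= (phi1 (y + 1) - phi1 y) + (phi2 (y + 1) - phi2 y) +
    ((phi3 (y + 1) - phi3 y) + (phi3 (y - 1 + 1) - phi3 (y - 1))).
  have h1 : 0 <= phi1 (y + 1) - phi1 y.
    by rewrite /phi1 opprK addrC subr_ge0 cut_mono //; lra.
  have h2 : 0 <= phi2 (y + 1) - phi2 y by rewrite /phi2 subr_ge0 cut_mono //; lra.
  have h3 z : 0 <= phi3 (z + 1) - phi3 z.
    by rewrite /phi3 /chi; case: (lerP 0 z) => ?; case: (lerP 0 (z + 1)) => ?; lra.
  have := h3 y; have := h3 (y - 1); rewrite subrK => h4 h5.
  have [y1|y1] := lerP 1 y.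
    have -> : `|rtD2 y| = phi1 (y + 1) - phi1 y.
      rewrite /phi1 addrK !cutE; [|lra..].
      rewrite /rtD2 ler0_norm; last by rewrite subr_le0 rtD_mono //; lra.
      by ring.
    lra.
  have [y2|y2] := lerP y (-1).
    have -> : `|rtD2 y| = phi2 (y + 1) - phi2 y.
      rewrite /phi2 !cutE; [|lra..].
      rewrite -rtD2N /rtD2 ler0_norm; last by rewrite subr_le0 rtD_mono //; lra.
      have -> : - (y + 1) = - y - 1 by ring.
      by ring.
    lra.
  have e1 : phi3 (y + 1) = 2 by rewrite /phi3 /chi; case: lerP => ?; lra.
  have e2 : phi3 (y - 1) = 0.
    by rewrite /phi3 /chi; case: lerP => ?; lra.
  have := rtD2_le2 y; lra.
have /le_trans -> // : \sum_(i < n) `|rtD2 (x + i%:R)| <=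
    (phi1 (x + n%:R) - phi1 x) + (phi2 (x + n%:R) - phi2 x) +
    ((phi3 (x + n%:R) - phi3 x) + (phi3 (x - 1 + n%:R) - phi3 (x - 1))).
  rewrite -!sum_diff -!big_split /=; apply: ler_sum => i _.
  by have -> : x - 1 + i%:R = x + i%:R - 1 by ring; exact: pt.
have b1 y : -1 <= phi1 y <= 0.
  have := cut_bnd (y - 1) (lexx 0); have := rtD_le1 0.
  by rewrite /phi1 ler_norml; lra.
have b2 y : 0 <= phi2 y <= 1.
  have := cut_bnd (- y) (lexx 0); have := rtD_le1 0.
  by rewrite /phi2 ler_norml; lra.
have b3 y : 0 <= phi3 y <= 2.
  by rewrite /phi3 /chi; case: (0 <= y); lra.
have := b1 (x + n%:R); have := b1 x; have := b2 (x + n%:R); have := b2 x.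
have := b3 (x + n%:R); have := b3 x; have := b3 (x - 1 + n%:R); have := b3 (x - 1); lra.
Qed.

Lemma sum_rtD2_rev x n : \sum_(i < n) `|rtD2 (x - i%:R)| <= 6.
Proof.
rewrite (eq_bigr (fun i : 'I_n => `|rtD2 (- x + i%:R)|)); first exact: sum_rtD2.
by move=> i _; rewrite -rtD2N opprB addrC.
Qed.

Lemma sum_cut_step x0 x n : 0 <= x0 ->
  \sum_(i < n) (cut x0 (x + i%:R) - cut x0 (x + i%:R + 3)) <= 3 * rtD x0.
Proof.
move=> h; have b y : - rtD x0 <= - cut x0 y <= 0 by have := cut_bnd y h; lra.
have := sum_diff3 x n b; rewrite opprK add0r; apply: le_trans.
by apply: ler_sum => i _; rewrite opprK addrC.
Qed.

Lemma sum_cut_step_rev x0 x n : 0 <= x0 ->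
  \sum_(i < n) (cut x0 (x - i%:R) - cut x0 (x - i%:R + 3)) <= 3 * rtD x0.
Proof.
move=> h; have b y : 0 <= cut x0 (- y) <= rtD x0 := cut_bnd (- y) h.
have := sum_diff3 (- x - 3) n b; rewrite subr0; apply: le_trans.
apply: ler_sum => i _.
have -> : - (- x - 3 + i%:R + 3) = x - i%:R by ring.
by have -> : - (- x - 3 + i%:R) = x - i%:R + 3 by ring.
Qed.

End cube_root.

(** * Positivity of the lattice sum of the kernel *)

Section kernel_sum.
Context (R : realType).
Implicit Types x h u : R.

(* Up to a factor, the covariances of an increment at distance h with the sum of
   2 L consecutive increments and with the sum of the three middle ones. *)
Definition ker3 (L : nat) h : R := rtD h - rtD (h - (2 * L)%:R).
Definition ker1 (L : nat) h : R := rtD (h - L%:R + 1) - rtD (h - L%:R - 2).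

Lemma ker_lb L h : (3 <= L)%N ->
  - (2 * rtD (L%:R - 3)) * ((cut (L%:R - 3) (h - L%:R - 2) - cut (L%:R - 3) (h - L%:R - 2 + 3)) +
     (cut (L%:R - 3) (L%:R - 2 - h) - cut (L%:R - 3) (L%:R - 2 - h + 3)))
  <= ker3 L h * ker1 L h ^+ 2.
Proof.
move=> L3; have L3R : 3 <= L%:R :> R by rewrite ler_nat.
set x0 := L%:R - 3; have x00 : 0 <= x0 by rewrite /x0; lra.
set mu := rtD x0; have mu0 : 0 <= mu by exact: rtD_ge0.
set u := h - L%:R - 2; set v := L%:R - 2 - h.
have cu : 0 <= cut x0 u - cut x0 (u + 3) by rewrite subr_ge0 cut_mono //; lra.
have cv : 0 <= cut x0 v - cut x0 (v + 3) by rewrite subr_ge0 cut_mono //; lra.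
have k3 : `|ker3 L h| <= 2.
  by have := rtD_le1 h; have := rtD_le1 (h - (2 * L)%:R); rewrite /ker3 !ler_norml; lra.
have bu := cut_bnd u x00; have bu3 := cut_bnd (u + 3) x00.
have bv := cut_bnd v x00; have bv3 := cut_bnd (v + 3) x00.
have sq (a b : R) : 0 <= b <= mu -> a = b \/ a = - b -> a ^+ 2 <= mu * b.
  by move=> /andP[b0 bm] [] ->; rewrite ?sqrrN expr2 ler_wpM2r.
have gen : ker1 L h ^+ 2 <= mu * ((cut x0 u - cut x0 (u + 3)) + (cut x0 v - cut x0 (v + 3))) ->
    - (2 * mu) * ((cut x0 u - cut x0 (u + 3)) + (cut x0 v - cut x0 (v + 3))) <= ker3 L h * ker1 L h ^+ 2.
  move=> hk; have : - 2 * ker1 L h ^+ 2 <= ker3 L h * ker1 L h ^+ 2.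
    by rewrite ler_wpM2r ?sqr_ge0 //; move: k3; rewrite ler_norml; lra.
  by lra.
have L2 : (2 * L)%:R = 2 * L%:R :> R by rewrite natrM.
have [h1|h1] := leP h 0.
  apply: gen; apply: le_trans (_ : mu * (cut x0 v - cut x0 (v + 3)) <= _); last by rewrite ler_wpM2l //; lra.
  apply: sq; first by move: bv bv3 cv; rewrite -/mu; lra.
  right; rewrite !cutE; [|rewrite /x0 /v; lra..].
  rewrite /ker1 (_ : h - L%:R + 1 = -1 - v); last by rewrite /v; ring.
  rewrite (_ : h - L%:R - 2 = -1 - (v + 3)); last by rewrite /v; ring.
  by rewrite !rtDN; ring.
have [h2|h2] := leP (2 * L%:R - 1) h.
  apply: gen; apply: le_trans (_ : mu * (cut x0 u - cut x0 (u + 3)) <= _); last by rewrite ler_wpM2l //; lra.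
  apply: sq; first by move: bu bu3 cu; rewrite -/mu; lra.
  right; rewrite !cutE; [|rewrite /x0 /u; lra..].
  rewrite /ker1 -/u (_ : h - L%:R + 1 = u + 3); last by rewrite /u; ring.
  by ring.
have p3 : 0 <= ker3 L h.
  rewrite /ker3 L2 (_ : h - 2 * L%:R = -1 - (2 * L%:R - 1 - h)); last by ring.
  by rewrite rtDN opprK addr_ge0 // rtD_ge0 // ?subr_ge0 ltW.
apply: (@le_trans _ _ 0); last by rewrite mulr_ge0 ?sqr_ge0.
by rewrite mulNr oppr_le0; apply: mulr_ge0; [exact: mulr_ge0|exact: addr_ge0].
Qed.

(** In the middle of the block each kernel is a difference of two values of [rtD] of opposite signs,
    so nothing cancels. The constant is 243 = 3 * 9^2, from the decay bound on [rtD (L + 1)] and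
    from [ker1] >= 1/9. *)
Lemma ker_near L u : (3 <= L)%N -> 0 <= u < 1 ->
  (243 * rt3 (L%:R + 2 : R) ^+ 2)^-1 <= ker3 L (u + L%:R) * ker1 L (u + L%:R) ^+ 2.
Proof.
move=> L3 u01; have L3R : 3 <= L%:R :> R by rewrite ler_nat.
have L2 : (2 * L)%:R = 2 * L%:R :> R by rewrite natrM.
have r0 : 0 < rt3 (L%:R + 2 : R).
  by rewrite (lt_le_trans (@ltr01 R)) // ler_rt3_r // expr1n ger0_norm; lra.
have k3 : (3 * rt3 (L%:R + 2 : R) ^+ 2)^-1 <= ker3 L (u + L%:R).
  have a1 : 0 <= - rtD (u + L%:R - (2 * L)%:R).
    rewrite L2 (_ : u + _ - _ = -1 - (L%:R - 1 - u)); last by ring.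
    by rewrite rtDN opprK rtD_ge0 //; lra.
  have a2 : rtD (L%:R + 1) <= rtD (u + L%:R) by rewrite rtD_mono //; lra.
  have a3 : 1 <= 3 * rt3 (L%:R + 1 + 1) ^+ 2 * rtD (L%:R + 1 : R) by apply: rtD_lb; lra.
  have e : (L%:R + 1 + 1 : R) = L%:R + 2 by ring.
  rewrite e in a3.
  have a4 : (3 * rt3 (L%:R + 2 : R) ^+ 2)^-1 <= rtD (L%:R + 1 : R).
    by rewrite -[leLHS]mul1r ler_pdivrMr 1?mulrC // mulr_gt0 // exprn_gt0.
  rewrite /ker3; lra.
have k1 : 9^-1 <= ker1 L (u + L%:R).
  rewrite /ker1 addrK.
  have a1 : 0 <= - rtD (u - 2).
    by rewrite (_ : u - 2 = -1 - (1 - u)) ?rtDN ?opprK ?rtD_ge0 //; [lra|ring].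
  have a3 : 1 <= 3 * rt3 (2 + 1) ^+ 2 * rtD (2 : R) by apply: rtD_lb; lra.
  have a2 : rtD 2 <= rtD (u + 1) by rewrite rtD_mono //; lra.
  have a4 : rt3 (2 + 1 : R) <= 3 / 2.
    by apply: rt3_ler; rewrite ?ger0_norm; lra.
  have a5 := rt3_ge0 (2 + 1 : R).
  have a6 : rt3 (2 + 1 : R) ^+ 2 <= 9 / 4 by nra.
  have a7 : 0 <= rtD (2 : R) by apply: rtD_ge0; lra.
  have : 1 <= 27 / 4 * rtD (2 : R) by nra.
  lra.
have k1s : 81^-1 <= ker1 L (u + L%:R) ^+ 2 by nra.
have i0 : 0 <= (3 * rt3 (L%:R + 2 : R) ^+ 2)^-1 by rewrite invr_ge0 mulr_ge0 // sqr_ge0.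
rewrite (_ : (243 * _)^-1 = (3 * rt3 (L%:R + 2 : R) ^+ 2)^-1 * 81^-1); last by field; rewrite gt_eqF.
by apply: ler_pM => //; lra.
Qed.

(* The term i = j + L is at least of order L ^ (-2/3) and all negative
   contributions together are O (rtD L ^ 2) = O (L ^ (-4/3)). *)
Lemma sum_ker_ge : exists (L : nat) (theta : R), [/\ (3 <= L)%N, 0 < theta &
  forall (N j : nat) u, 0 <= u < 1 -> (j + L < N)%N ->
  theta <= \sum_(i < N) ker3 L (u + i%:R - j%:R) * ker1 L (u + i%:R - j%:R) ^+ 2].
Proof.
(* With y = [rt3 (L - 3)], the loss 12 [rtD (L - 3)]^2 is at most 4 / (3 y^4) and the gain at least
   1 / (972 y^2), so y > 36 is enough. The four successors leave L - 3 above 40^3. *)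
pose L := (Num.truncn (40 ^+ 3 : R)).+4.
have L3 : (3 <= L)%N by [].
have LR : 40 ^+ 3 <= L%:R - 3 :> R.
  have /andP[_ h] := @Num.Theory.truncn_itv R (40 ^+ 3) (exprn_ge0 3 (ler0n R 40)).
  have -> : L%:R = (Num.truncn (40 ^+ 3 : R)).+1%:R + 3 :> R by rewrite -natrD addn3.
  by rewrite addrK ltW.
pose theta := (243 * rt3 (L%:R + 2 : R) ^+ 2)^-1 - 12 * rtD (L%:R - 3 : R) ^+ 2.
exists L, theta; split => //.
  rewrite /theta subr_gt0.
  have y40 : 40 <= rt3 (L%:R - 3 : R).
    by apply: ler_rt3_r => //; rewrite ger0_norm //; apply: le_trans LR; rewrite exprn_ge0.
  have c40 : (1 : R) <= 40 ^+ 3 by rewrite exprn_ege1 //; lra.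
  have yL : rt3 (L%:R + 2 : R) <= 2 * rt3 (L%:R - 3 : R).
    apply: rt3_ler; first by have := rt3_ge0 (L%:R - 3 : R); lra.
    by rewrite exprMn rt3_cube !ger0_norm; lra.
  have r0 := rt3_ge0 (L%:R + 2 : R).
  have r1 : 1 <= rt3 (L%:R + 2 : R) by apply: ler_rt3_r; rewrite ?expr1n ?ger0_norm; lra.
  have ub := @rtD_ub R (L%:R - 3) ltac:(lra).
  have m0 : 0 <= rtD (L%:R - 3 : R) by apply: rtD_ge0; lra.
  move: ub m0 yL y40 r1; move: (rtD _) (rt3 _) (rt3 _) => m z y ub m0 zy y40 z1.
  rewrite -[ltRHS]mul1r ltr_pdivlMr; last by rewrite mulr_gt0 // exprn_gt0 // (lt_le_trans ltr01).
  have z2 : z ^+ 2 <= 4 * y ^+ 2 by nra.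
  have my : m * y ^+ 2 <= 3^-1 by lra.
  have m1 : m * 1600 <= 3^-1.
    apply: le_trans my; rewrite ler_wpM2l //; nra.
  have : m ^+ 2 * z ^+ 2 <= m * (4 * (m * y ^+ 2)).
    by rewrite (_ : m * (4 * _) = m ^+ 2 * (4 * y ^+ 2)); [rewrite ler_wpM2l ?sqr_ge0|ring].
  have : m * (m * y ^+ 2) <= m * 3^-1 by rewrite ler_wpM2l.
  lra.
move=> N j u u01 jN.
have jLN : (j + L < N)%N := jN.
pose i0 := Ordinal jLN.
pose lb (i : 'I_N) := - (2 * rtD (L%:R - 3)) *
  ((cut (L%:R - 3) (u - j%:R - L%:R - 2 + i%:R) - cut (L%:R - 3) (u - j%:R - L%:R - 2 + i%:R + 3)) +
   (cut (L%:R - 3) (L%:R - 2 - u + j%:R - i%:R) - cut (L%:R - 3) (L%:R - 2 - u + j%:R - i%:R + 3))).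
have x00 : 0 <= L%:R - 3 :> R by apply: le_trans LR; rewrite exprn_ge0.
have m0 : 0 <= rtD (L%:R - 3 : R) by exact: rtD_ge0.
have lbE (i : 'I_N) : lb i <= ker3 L (u + i%:R - j%:R) * ker1 L (u + i%:R - j%:R) ^+ 2.
  have := ker_lb (u + i%:R - j%:R) L3; rewrite /lb.
  have -> : u + i%:R - j%:R - L%:R - 2 = u - j%:R - L%:R - 2 + i%:R by ring.
  by have -> : L%:R - 2 - (u + i%:R - j%:R) = L%:R - 2 - u + j%:R - i%:R by ring.
have lb0 i : lb i <= 0.
  rewrite /lb mulNr oppr_le0 mulr_ge0 //; first by rewrite mulr_ge0.
  by rewrite addr_ge0 // subr_ge0 cut_mono //; lra.
have sl : - (12 * rtD (L%:R - 3) ^+ 2) <= \sum_(i < N) lb i.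
  rewrite -mulr_sumr big_split /=.
  have s1 := sum_cut_step (u - j%:R - L%:R - 2) N x00.
  have s2 := sum_cut_step_rev (L%:R - 2 - u + j%:R) N x00.
  nra.
rewrite (bigD1 i0) //=.
have near := ker_near L3 u01.
have eq0 : u + (j + L)%:R - j%:R = u + L%:R by rewrite natrD; ring.
rewrite eq0.
have s3 : \sum_(i < N) lb i <= \sum_(i < N | i != i0) ker3 L (u + i%:R - j%:R) * ker1 L (u + i%:R - j%:R) ^+ 2.
  rewrite (bigD1 i0) //=.
  have : \sum_(i < N | i != i0) lb i <= \sum_(i < N | i != i0) ker3 L (u + i%:R - j%:R) * ker1 L (u + i%:R - j%:R) ^+ 2.
    by apply: ler_sum => i _; exact: lbE.
  have := lb0 i0; lra.
rewrite /theta; lra.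
Qed.

End kernel_sum.

(** * Means and Gaussian moments *)

(** The density agrees almost everywhere with the Radon-Nikodym derivative, both having the same
    integral over every measurable set. *)
Lemma ge0_integral_normal_prob (R : realType) (m s : R) (f : measurableTypeR R -> \bar R) :
  (forall x, 0 <= f x)%E -> measurable_fun [set: R] f ->
  (\int[normal_prob m s]_x f x =
   \int[lebesgue_measure]_x (f x * (normal_pdf m s x)%:E))%E.
Proof.
move=> f0 mf.
have dom : normal_prob m s `<< @lebesgue_measure R := normal_prob_dominates m s.
have ipdf := @integrable_normal_pdf R m s.
rewrite -(Radon_Nikodym_SigmaFinite.change_of_variables dom) //.
have fint := Radon_Nikodym_SigmaFinite.f_integrable dom.
apply: ae_eq_integral => //.
- by apply: emeasurable_funM => //; exact: (measurable_int _ fint).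
- by apply: emeasurable_funM => //; exact: (measurable_int _ ipdf).
apply: ae_eqe_mul2l => /=.
apply: integral_ae_eq => //=.
  exact: (measurable_int _ ipdf).
by move=> E _ mE; rewrite -Radon_Nikodym_SigmaFinite.f_integral.
Qed.

(** Completing the square turns the tilted density into a multiple of the normal density with mean m
    + s^2 v. *)
Lemma normal_prob_mgf (R : realType) (m s v : R) : s != 0 ->
  (\int[normal_prob m s]_x (expR (v * x))%:E =
   (expR (m * v + s ^+ 2 * v ^+ 2 / 2))%:E)%E.
Proof.
move=> s0.
have mexp : measurable_fun [set: R] (fun x : R => (expR (v * x))%:E).
  apply/measurable_EFinP.
  exact: (measurableT_comp (@measurable_expR R) (@mulrl_measurable R _ v)).
rewrite ge0_integral_normal_prob //.
under eq_integral => x _.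
  have -> : ((expR (v * x))%:E * (normal_pdf m s x)%:E =
     (expR (m * v + s ^+ 2 * v ^+ 2 / 2))%:E *
     (normal_pdf (m + s ^+ 2 * v) s x)%:E)%E.
    rewrite -!EFinM !normal_pdfE //= mulrCA [in RHS]mulrCA /normal_fun -!expRD.
    by congr (_ * expR _)%:E; field; rewrite s0.
  over.
rewrite integralZl //; last exact: integrable_normal_pdf.
by rewrite integral_normal_pdf mule1.
Qed.

Section has_mean.
Context d (Omega : measurableType d) (R : realType) (P : probability Omega R).
Implicit Types f g : Omega -> R.

(** Integrability travels with the value: the real-valued integral is 0 when the extended one is
    infinite, so the value alone would say little. *)
Definition has_mean f (v : R) : Prop :=
  P.-integrable setT (EFin \o f) /\ \int[P]_w f w = v.

Lemma has_mean_measurable f v : has_mean f v -> measurable_fun setT f.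
Proof. by case=> /measurable_int/measurable_EFinP. Qed.

Lemma eq_has_mean f g v : f =1 g -> has_mean f v -> has_mean g v.
Proof. by move=> /funext ->. Qed.

Lemma has_mean_subst f g a b : has_mean f a -> f =1 g -> a = b -> has_mean g b.
Proof. by move=> + /funext <- <-. Qed.

Lemma has_mean_cst c : has_mean (fun=> c) c.
Proof.
split; first exact: finite_measure_integrable_cst.
rewrite Rintegral_cst //.
rewrite -[RHS]mulr1; congr (_ * _).
exact: (congr1 fine (probability_setT P)).
Qed.

Lemma has_meanD f g a b :
  has_mean f a -> has_mean g b -> has_mean (fun w => f w + g w) (a + b).
Proof.
move=> [fi fa] [gi gb]; split; last by rewrite RintegralD // fa gb.
by rewrite [X in integrable _ _ X](_ : _ = (EFin \o f) \+ (EFin \o g))%E //; exact: integrableD.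
Qed.

Lemma has_meanZ k f a : has_mean f a -> has_mean (fun w => k * f w) (k * a).
Proof.
move=> [fi fa]; split; last by rewrite RintegralZl // fa.
by rewrite [X in integrable _ _ X](_ : _ = (fun w => k%:E * (EFin \o f) w)%E) //; exact: integrableZl.
Qed.

Lemma has_meanB f g a b :
  has_mean f a -> has_mean g b -> has_mean (fun w => f w - g w) (a - b).
Proof.
move=> fa /(has_meanZ (-1)) gb; have := has_meanD fa gb.
by rewrite mulN1r; apply: eq_has_mean => w; rewrite mulN1r.
Qed.

Lemma has_mean_sum (I : Type) (s : seq I) (Q : pred I) (f : I -> Omega -> R) (a : I -> R) :
  (forall i, Q i -> has_mean (f i) (a i)) ->
  has_mean (fun w => \sum_(i <- s | Q i) f i w) (\sum_(i <- s | Q i) a i).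
Proof.
move=> h; elim: s => [|i s ih].
  by rewrite big_nil; apply: eq_has_mean (has_mean_cst 0) => w; rewrite big_nil.
rewrite big_cons; case: ifPn => Qi.
  by apply: eq_has_mean (has_meanD (h i Qi) ih) => w; rewrite big_cons Qi.
by apply: eq_has_mean ih => w; rewrite big_cons (negbTE Qi).
Qed.

Lemma ler_has_mean f g a b :
  has_mean f a -> has_mean g b -> (forall w, f w <= g w) -> a <= b.
Proof. by move=> [fi <-] [gi <-] fg; exact: le_Rintegral. Qed.

Lemma has_mean_unique f a b : has_mean f a -> has_mean f b -> a = b.
Proof. by move=> [_ <-] [_ <-]. Qed.

Lemma has_mean_int f : P.-integrable setT (EFin \o f) ->
  has_mean f (\int[P]_w f w).
Proof. by []. Qed.

Lemma le_integrable_real f g : measurable_fun setT f ->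
  P.-integrable setT (EFin \o g) -> (forall w, `|f w| <= g w) ->
  P.-integrable setT (EFin \o f).
Proof.
move=> mf gi fg; apply: le_integrable gi => //; first exact/measurable_EFinP.
by move=> w _; rewrite /= lee_fin (le_trans (fg w)) // ler_norm.
Qed.

Lemma has_mean_ge0 f (v : R) : measurable_fun setT f -> (forall w, 0 <= f w) ->
  (\int[P]_w (f w)%:E = v%:E)%E -> has_mean f v.
Proof.
move=> mf f0 fv; split; last by rewrite /Rintegral fv.
apply/integrableP; split; first exact/measurable_EFinP.
under eq_integral => w _ do rewrite /= ger0_norm //.
by rewrite fv ltry.
Qed.

Lemma has_mean_indic (A : set Omega) : measurable A ->
  has_mean (\1_A) (fine (P A)).
Proof.
move=> mA; apply: has_mean_ge0; first exact: measurable_indic.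
  by move=> w; rewrite indicE.
by rewrite integral_indic // setIT fineK // fin_num_measure.
Qed.

(** From here on the Gaussian law enters only through its exponential moments. *)
Lemma gaussian_rv_mgf (Y : Omega -> R) : measurable_fun setT Y ->
  gaussian_rv P Y -> exists m s : R, forall v,
    has_mean (fun w => expR (v * Y w)) (expR (m * v + s ^+ 2 * v ^+ 2 / 2)).
Proof.
move=> mY [m [s [s0 law]]]; exists m, s => v.
pose Z : Omega -> measurableTypeR R := Y.
have mZ : measurable_fun setT Z by [].
have mexp : measurable_fun [set: measurableTypeR R] (fun x : R => (expR (v * x))%:E).
  apply/measurable_EFinP.
  exact: (measurableT_comp (@measurable_expR R) (@mulrl_measurable R _ v)).
apply: has_mean_ge0 => [||].
- apply: measurableT_comp; first exact: measurable_expR.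
  exact: measurable_funM.
- by move=> w; exact: expR_ge0.
have -> : (\int[P]_w (expR (v * Y w))%:E =
    \int[pushforward P Z]_x (expR (v * x))%:E)%E.
  by rewrite ge0_integral_pushforward // => x _; rewrite lee_fin expR_ge0.
have [s00|sn0] := eqVneq s 0.
  have -> : (\int[pushforward P Z]_x (expR (v * x))%:E =
      \int[dirac (m : measurableTypeR R)]_x (expR (v * x))%:E)%E.
    apply: eq_measure_integral => A mA _.
    transitivity (gaussian_law m s A); first exact: law.
    by rewrite /gaussian_law s00 eqxx.
  rewrite integral_dirac // diracT mul1e s00.
  by congr (expR _)%:E; ring.
rewrite -normal_prob_mgf //.
apply: eq_measure_integral => A mA _.
transitivity (gaussian_law m s A); first exact: law.
by rewrite /gaussian_law (negbTE sn0).
Qed.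

(* Differentiation in v under the mean: multiplying by B turns the polynomial
   factor p into p' + (c + b v) p. *)
Lemma has_mean_derive (F B : Omega -> R) (p : {poly R}) (c b : R) :
    measurable_fun setT B ->
    (forall v, has_mean (fun w => F w * expR (v * B w))
                 (p.[v] * expR (c * v + b * v ^+ 2 / 2))) ->
  forall v, has_mean (fun w => F w * B w * expR (v * B w))
     ((p^`() + (c%:P + b *: 'X) * p).[v] * expR (c * v + b * v ^+ 2 / 2)).
Proof.
move=> mB hF v.
have mF : measurable_fun setT F.
  have := has_mean_measurable (hF 0).
  by under eq_fun do rewrite mul0r expR0 mulr1.
pose f (x : R) w := F w * expR (x * B w).
have df x w : is_derive x (1 : R) (f ^~ w) (F w * B w * expR (x * B w)).
  rewrite /f; apply: is_derive_eq.
  by rewrite /GRing.scale /=; ring.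
(* A dominating function for |x - v| < 1: one unit in the exponent pays for moving x, the other for
   |B| <= exp |B|, and the two terms cover both signs of B. *)
pose G w := `|F w| * expR ((v + 2) * B w) + `|F w| * expR ((v - 2) * B w).
have intabs x : P.-integrable setT (EFin \o (fun w => `|F w| * expR (x * B w))).
  have := integrable_norm (hF x).1.
  apply: eq_integrable => // w _ /=.
  by rewrite normrM (ger0_norm (expR_ge0 _)).
have intG : P.-integrable setT (EFin \o G).
  by have [+ _] := has_meanD (has_mean_int (intabs (v + 2))) (has_mean_int (intabs (v - 2))).
have mder x : measurable_fun setT (fun w => F w * B w * expR (x * B w)).
  apply: measurable_funM; first exact: measurable_funM.
  apply: measurableT_comp; first exact: measurable_expR.
  exact: measurable_funM.
have bnd x w : v - 1 < x < v + 1 -> `|F w * B w * expR (x * B w)| <= G w.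
  move=> /andP[x1 x2].
  rewrite !normrM (ger0_norm (expR_ge0 _)) /G -mulrDr -mulrA ler_wpM2l //.
  have absB : `|B w| <= expR `|B w| by have := expR_ge1Dx `|B w|; lra.
  apply: (le_trans (ler_wpM2r (expR_ge0 _) absB)); rewrite -expRD.
  have [B0|/ltW B0] := lerP 0 (B w).
    rewrite ger0_norm //; have : expR (B w + x * B w) <= expR ((v + 2) * B w).
      by rewrite ler_expR; nra.
    by have := expR_ge0 ((v - 2) * B w); lra.
  rewrite ler0_norm //; have : expR (- B w + x * B w) <= expR ((v - 2) * B w).
    by rewrite ler_expR; nra.
  by have := expR_ge0 ((v + 2) * B w); lra.
have intd := le_integrable_real (mder v) intG.
split.
  apply: intd => w; apply: bnd; lra.
have vI : `]v - 1, v + 1[%classic v by rewrite /= in_itv /=; lra.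
have dE x w : partial1of2 f x w = F w * B w * expR (x * B w).
  by rewrite partial1of2E derive_val.
have GI : forall x w, `]v - 1, v + 1[%classic x -> setT w -> `|partial1of2 f x w| <= G w.
  by move=> x w; rewrite /= in_itv /= => xI _; rewrite dE; exact: bnd.
have G0 w : 0 <= G w by rewrite addr_ge0 // mulr_ge0 // expR_ge0.
have := @differentiation_under_integral R d Omega P f setT measurableT v (v - 1) (v + 1) vI
  (fun x _ => (hF x).1) (fun x w _ _ => @ex_derive _ _ _ _ _ _ _ (df x w)) G G0 intG GI.
rewrite [X in _ = X -> _](_ : _ = \int[P]_w (F w * B w * expR (v * B w))); last first.
  by apply: eq_Rintegral => w _; rewrite -dE.
move=> <-.
rewrite (_ : (fun x => \int[P]_w f x w) = (fun x => p.[x] * expR (c * x + b * x ^+ 2 / 2))); last first.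
  by apply/funext => x; exact: (hF x).2.
rewrite derive1E.
have h : is_derive v 1 (fun x : R => p.[x] * expR (c * x + b * x ^+ 2 / 2))
    ((p^`() + (c%:P + b *: 'X) * p).[v] * expR (c * v + b * v ^+ 2 / 2)).
  by apply: is_derive_eq; rewrite !hornerE /GRing.scale /=; field.
by rewrite derive_val.
Qed.

End has_mean.

Lemma expR_at0 (R : realType) (c b : R) : expR (c * 0 + b * 0 ^+ 2 / 2) = 1.
Proof. by rewrite expr0n /= !mulr0 mul0r addr0 expR0. Qed.

(** * Linear span of the process and its covariances *)

Section gaussian_span.
Context d (Omega : measurableType d) (R : realType) (P : probability Omega R).
Variable X : R -> {RV P >-> R}.

Definition gspan (B : Omega -> R) : Prop :=
  exists (n : nat) (t a : 'I_n -> R), (forall i, 0 <= t i) /\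
    B = fun w => \sum_(i < n) a i * X (t i) w.

(** This is a covariance because elements of the span are centered. *)
Definition cov (A B : Omega -> R) : R := \int[P]_w (A w * B w).

Lemma gspan_eq A B : A =1 B -> gspan A -> gspan B.
Proof. by move=> /funext ->. Qed.

Lemma gspan_X t : 0 <= t -> gspan (X t).
Proof.
move=> t0; exists 1, (fun=> t), (fun=> 1); split=> //.
by apply/funext => w; rewrite big_ord1 mul1r.
Qed.

Lemma gspanZ k A : gspan A -> gspan (fun w => k * A w).
Proof.
move=> [n [t [a [t0 ->]]]]; exists n, t, (fun i => k * a i); split=> //.
by apply/funext => w; rewrite mulr_sumr; apply: eq_bigr => i _; rewrite mulrA.
Qed.

Lemma gspanD A B : gspan A -> gspan B -> gspan (fun w => A w + B w).
Proof.
move=> [n [t [a [t0 ->]]]] [m [s [b [s0 ->]]]].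
pose glue (f : 'I_n -> R) (g : 'I_m -> R) (i : 'I_(n + m)) :=
  match fintype.split i with inl j => f j | inr j => g j end.
exists (n + m)%N, (glue t s), (glue a b); split.
  by move=> i; rewrite /glue; case: fintype.split.
apply/funext => w; rewrite big_split_ord /=; congr (_ + _); apply: eq_bigr => i _.
  by rewrite /glue (unsplitK (inl _ i)).
by rewrite /glue (unsplitK (inr _ i)).
Qed.

Lemma gspanN A : gspan A -> gspan (fun w => - A w).
Proof. by move=> /(gspanZ (-1)); apply: gspan_eq => w; rewrite mulN1r. Qed.

Lemma gspanB A B : gspan A -> gspan B -> gspan (fun w => A w - B w).
Proof. by move=> gA /gspanN; exact: gspanD. Qed.

Lemma gspan0 : gspan (fun=> 0).
Proof.
exists 0, (fun=> 0), (fun=> 0); split=> //.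
by apply/funext => w; rewrite big_ord0.
Qed.

Lemma gspan_sum (I : Type) (s : seq I) (Q : pred I) (B : I -> Omega -> R) :
  (forall i, Q i -> gspan (B i)) -> gspan (fun w => \sum_(i <- s | Q i) B i w).
Proof.
move=> h; elim: s => [|i s ih].
  by apply: gspan_eq gspan0 => w; rewrite big_nil.
case Qi : (Q i); last by apply: gspan_eq ih => w; rewrite big_cons Qi.
by apply: gspan_eq (gspanD (h i Qi) ih) => w; rewrite big_cons Qi.
Qed.

Lemma gspan_measurable B : gspan B -> measurable_fun setT B.
Proof.
move=> [n [t [a [_ ->]]]]; apply: measurable_sum => i.
exact: measurable_funM.
Qed.

Hypothesis gX : gaussian_process X.
Hypothesis cX : forall t : R, 0 <= t -> ('E_P[X t] = 0)%E.

(** Two derivatives of the moment-generating function at 0 identify the parameters of the law with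
    the mean and the variance. *)
Lemma gspan_mgf_moments B : gspan B -> exists m s : R,
  [/\ forall v, has_mean P (fun w => expR (v * B w)) (expR (m * v + s ^+ 2 * v ^+ 2 / 2)),
      has_mean P B m & has_mean P (fun w => B w * B w) (s ^+ 2 + m ^+ 2)].
Proof.
move=> gB; have mB := gspan_measurable gB.
have [m [s mgf]] : exists m s : R, forall v,
    has_mean P (fun w => expR (v * B w)) (expR (m * v + s ^+ 2 * v ^+ 2 / 2)).
  apply: gaussian_rv_mgf => //.
  by case: gB => n [t [a [t0 ->]]]; exact: gX.
exists m, s.
have h0 v : has_mean P (fun w => 1 * expR (v * B w))
    ((1%:P).[v] * expR (m * v + s ^+ 2 * v ^+ 2 / 2)).
  by rewrite hornerC mul1r; apply: eq_has_mean (mgf v) => w; rewrite mul1r.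
have h1 := has_mean_derive mB h0.
have h2 := has_mean_derive mB h1.
split=> //.
  apply: (has_mean_subst (h1 0)) => [w|]; first by rewrite mul0r expR0 mulr1 mul1r.
  rewrite expR_at0 !poly.derivE !(hornerE, hornerMn, hornerXn) /=.
by ring.
apply: (has_mean_subst (h2 0)) => [w|]; first by rewrite mul0r expR0 mulr1 mul1r.
rewrite expR_at0 !poly.derivE !(hornerE, hornerMn, hornerXn) /=.
by ring.
Qed.

Lemma gspan_mean0 B : gspan B -> has_mean P B 0.
Proof.
move=> [n [t [a [t0 ->]]]].
suff h i : has_mean P (X (t i)) 0.
  have := has_mean_sum (index_enum 'I_n) (fun i (_ : xpredT i) => has_meanZ (a i) (h i)).
  by rewrite [X in has_mean _ _ X]big1 // => i _; rewrite mulr0.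
have [m [s [_ hm _]]] := gspan_mgf_moments (gspan_X (t0 i)).
suff <- : m = 0 by [].
case: hm => _ <-; have := cX (t0 i).
by rewrite unlock /Rintegral => ->.
Qed.

Lemma gspan_mgf B v : gspan B ->
  has_mean P (fun w => expR (v * B w)) (expR (cov B B * v ^+ 2 / 2)).
Proof.
move=> gB; have [m [s [mgf mB sB]]] := gspan_mgf_moments gB.
have m0 : m = 0 := has_mean_unique mB (gspan_mean0 gB).
have -> : cov B B = s ^+ 2 by rewrite /cov sB.2 m0; ring.
by have := mgf v; rewrite m0 mul0r add0r.
Qed.

Lemma gspan_sq B : gspan B -> has_mean P (fun w => B w * B w) (cov B B).
Proof. by move=> /gspan_mgf_moments [m [s [_ _ [iB _]]]]. Qed.

Lemma gspan_mul A B : gspan A -> gspan B ->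
  has_mean P (fun w => A w * B w) (cov A B).
Proof.
move=> gA gB.
have [+ _] := has_meanZ (1 / 4) (has_meanB (gspan_sq (gspanD gA gB)) (gspan_sq (gspanB gA gB))).
move=> iAB; apply: has_mean_int; apply: eq_integrable iAB => // w _ /=.
by congr (_%:E); field.
Qed.

Lemma covC A B : cov A B = cov B A.
Proof. by apply: eq_Rintegral => w _; rewrite mulrC. Qed.

Lemma covDl A B C : gspan A -> gspan B -> gspan C ->
  cov (fun w => A w + B w) C = cov A C + cov B C.
Proof.
move=> gA gB gC; apply: has_mean_unique (gspan_mul (gspanD gA gB) gC) _.
by apply: eq_has_mean (has_meanD (gspan_mul gA gC) (gspan_mul gB gC)) => w; rewrite mulrDl.
Qed.

Lemma covZl k A C : gspan A -> gspan C -> cov (fun w => k * A w) C = k * cov A C.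
Proof.
move=> gA gC; apply: has_mean_unique (gspan_mul (gspanZ k gA) gC) _.
by apply: eq_has_mean (has_meanZ k (gspan_mul gA gC)) => w; rewrite mulrA.
Qed.

Lemma covNl A C : gspan A -> gspan C -> cov (fun w => - A w) C = - cov A C.
Proof.
move=> gA gC; rewrite -mulN1r -covZl //.
by congr cov; apply/funext => w; rewrite mulN1r.
Qed.

Lemma covBl A B C : gspan A -> gspan B -> gspan C ->
  cov (fun w => A w - B w) C = cov A C - cov B C.
Proof. by move=> gA gB gC; rewrite covDl ?covNl //; exact: gspanN. Qed.

Lemma cov_suml (I : Type) (s : seq I) (B : I -> Omega -> R) C :
  (forall i, gspan (B i)) -> gspan C ->
  cov (fun w => \sum_(i <- s) B i w) C = \sum_(i <- s) cov (B i) C.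
Proof.
move=> gB gC; have gS := @gspan_sum I s xpredT B (fun i _ => gB i).
apply: has_mean_unique (gspan_mul gS gC) _.
apply: eq_has_mean (has_mean_sum s (fun i (_ : xpredT i) => gspan_mul (gB i) gC)) => w.
by rewrite mulr_suml.
Qed.

Lemma covDr A B C : gspan A -> gspan B -> gspan C ->
  cov C (fun w => A w + B w) = cov C A + cov C B.
Proof. by move=> gA gB gC; rewrite covC covDl // !(covC C). Qed.

Lemma covZr k A C : gspan A -> gspan C -> cov C (fun w => k * A w) = k * cov C A.
Proof. by move=> gA gC; rewrite covC covZl // (covC C). Qed.

Lemma covNr A C : gspan A -> gspan C -> cov C (fun w => - A w) = - cov C A.
Proof. by move=> gA gC; rewrite covC covNl // (covC C). Qed.

Lemma covBr A B C : gspan A -> gspan B -> gspan C ->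
  cov C (fun w => A w - B w) = cov C A - cov C B.
Proof. by move=> gA gB gC; rewrite covC covBl // !(covC C). Qed.

(** The mean of exp(v A + B) is known for all v; three derivatives in v at 0 bring down A^3. *)
Lemma gspan_cube_exp A B : gspan A -> gspan B ->
  has_mean P (fun w => A w ^+ 3 * expR (B w))
    (expR (cov B B / 2) * (3 * cov A A * cov A B + cov A B ^+ 3)).
Proof.
move=> gA gB; have mA := gspan_measurable gA.
have h0 v : has_mean P (fun w => expR (B w) * expR (v * A w))
    (((expR (cov B B / 2))%:P).[v] * expR (cov A B * v + cov A A * v ^+ 2 / 2)).
  have gvAB := gspanD (gspanZ v gA) gB.
  have := gspan_mgf 1 gvAB.
  rewrite covDl ?covDr ?covZl ?covZr ?(covC B A) //; [|exact: gspanZ..].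
  rewrite hornerC -expRD.
  rewrite [X in has_mean _ _ (expR X) -> _](_ : _ = cov B B / 2 + (cov A B * v + cov A A * v ^+ 2 / 2)); last by field.
  by apply: eq_has_mean => w; rewrite mul1r -expRD addrC.
apply: (has_mean_subst (has_mean_derive mA (has_mean_derive mA (has_mean_derive mA h0)) 0)) => [w|].
  by rewrite mul0r expR0; ring.
rewrite expR_at0 !poly.derivE !(hornerE, hornerMn, hornerXn) /=.
by ring.
Qed.

(** Wick's formula for six factors: of the 15 pairings, 9 have a single cross pair and 6 have three.
    It comes from [gspan_cube_exp] with v B in place of B, differentiated three times at v = 0. *)
Lemma gspan_cube_cube A B : gspan A -> gspan B ->
  has_mean P (fun w => A w ^+ 3 * B w ^+ 3)
    (9 * cov A A * cov B B * cov A B + 6 * cov A B ^+ 3).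
Proof.
move=> gA gB; have mB := gspan_measurable gB.
have h0 v : has_mean P (fun w => A w ^+ 3 * expR (v * B w))
    (((3 * cov A A * cov A B) *: 'X + (cov A B ^+ 3) *: 'X ^+ 3).[v] *
       expR (0 * v + cov B B * v ^+ 2 / 2)).
  apply: (has_mean_subst (gspan_cube_exp gA (gspanZ v gB))) => //.
  rewrite covZl ?covZr //; last exact: gspanZ.
  rewrite mulrC; congr (_ * expR _); last by ring.
  rewrite !(hornerE, hornerXn) /=.
  by ring.
apply: (has_mean_subst (has_mean_derive mB (has_mean_derive mB (has_mean_derive mB h0)) 0)) => [w|].
  by rewrite mul0r expR0; ring.
rewrite expR_at0 !poly.derivE !(hornerE, hornerMn, hornerXn) /=.
by ring.
Qed.

End gaussian_span.

(** * Fourth moments of hyperbolic sines *)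

Section hyperbolic.
Context (R : realType).
Implicit Types x k : R.

Definition sinh x : R := (expR x - expR (- x)) / 2.
Definition cosh x : R := (expR x + expR (- x)) / 2.

Lemma expR_cosh_sinh x : expR x = cosh x + sinh x.
Proof. by rewrite /cosh /sinh; field. Qed.

Lemma expRN_cosh_sinh x : expR (- x) = cosh x - sinh x.
Proof. by rewrite /cosh /sinh; field. Qed.

Lemma sinhN x : sinh (- x) = - sinh x.
Proof. by rewrite /sinh opprK; field. Qed.

Lemma norm_sinh_le k x : `|x| <= k -> `|sinh x| <= 2 * expR k * `|x|.
Proof.
wlog x0 : x / 0 <= x.
  move=> hw; have /orP[|h] := le_total 0 x; first exact: hw.
  by rewrite -(normrN x) -(normrN (sinh x)) -sinhN; apply: hw; lra.
rewrite (ger0_norm x0) => xk.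
have h1 := expR_ge1Dx (- x); have h2 := expR_ge1Dx x.
have h3 := expRxMexpNx_1 x; have h4 := expR_gt0 x; have h5 := expR_gt0 (- x).
have h6 : expR x <= expR k by rewrite ler_expR.
have h7 : expR x - 1 <= x * expR x by nra.
have h8 : x * expR x <= x * expR k by rewrite ler_wpM2l.
have h9 : expR (- x) <= 1 by rewrite -expR0 ler_expR; lra.
have h10 : x <= x * expR k by nra.
rewrite ger0_norm; last by rewrite /sinh; nra.
rewrite /sinh; nra.
Qed.

Lemma norm_cosh_le k x : `|x| <= k -> `|cosh x| <= 2 * expR k.
Proof.
move=> xk; have := expR_gt0 x; have := expR_gt0 (- x) => h1 h2.
have h3 : expR x <= expR k by rewrite ler_expR (le_trans (ler_norm x)).
have h4 : expR (- x) <= expR k by rewrite ler_expR (le_trans _ xk) // -normrN ler_norm.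
rewrite /cosh ger0_norm; lra.
Qed.

(* One term for each graph on four vertices with all degrees odd: three perfect
   matchings, four stars and the complete graph. *)
Definition sinh4 (c12 c13 c14 c23 c24 c34 : R) : R :=
  sinh c12 * sinh c34 * (cosh c13 * cosh c14 * cosh c23 * cosh c24) +
  sinh c13 * sinh c24 * (cosh c12 * cosh c14 * cosh c23 * cosh c34) +
  sinh c14 * sinh c23 * (cosh c12 * cosh c13 * cosh c24 * cosh c34) +
  sinh c12 * sinh c13 * sinh c14 * (cosh c23 * cosh c24 * cosh c34) +
  sinh c12 * sinh c23 * sinh c24 * (cosh c13 * cosh c14 * cosh c34) +
  sinh c13 * sinh c23 * sinh c34 * (cosh c12 * cosh c14 * cosh c24) +
  sinh c14 * sinh c24 * sinh c34 * (cosh c12 * cosh c13 * cosh c23) +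
  sinh c12 * sinh c34 * (sinh c13 * sinh c14 * sinh c23 * sinh c24).

(** The constant E dominates both |sinh| and |cosh| on [-k, k]. Each term keeps two or three edges
    as covariances and spends the remaining factors on E, six powers of E in all. The complete graph
    is charged to the matching {12, 34}, hence the factor 2. *)
Lemma norm_sinh4_le k : exists2 C, 0 <= C & forall c12 c13 c14 c23 c24 c34 : R,
  `|c12| <= k -> `|c13| <= k -> `|c14| <= k -> `|c23| <= k -> `|c24| <= k -> `|c34| <= k ->
  sinh4 c12 c13 c14 c23 c24 c34 <= C * (
    (`|c12| * `|c34| + `|c13| * `|c24| + `|c14| * `|c23|) +
    (`|c12| * `|c13| * `|c14| + `|c12| * `|c23| * `|c24| +
     `|c13| * `|c23| * `|c34| + `|c14| * `|c24| * `|c34|)).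
Proof.
pose D := 2 * expR k.
have D0 : 0 <= D by rewrite /D mulr_ge0 // expR_ge0.
pose E := D * (1 + `|k|).
have DE : D <= E by rewrite /E mulrDr mulr1 lerDl mulr_ge0.
have E0 : 0 <= E by apply: le_trans DE.
have sE x : `|x| <= k -> `|sinh x| <= E.
  move=> xk; apply: (le_trans (norm_sinh_le xk)); rewrite -/D /E ler_wpM2l //.
  by have := ler_norm k; lra.
have sD x : `|x| <= k -> `|sinh x| <= E * `|x|.
  by move=> xk; apply: (le_trans (norm_sinh_le xk)); rewrite -/D ler_wpM2r.
have cE x : `|x| <= k -> `|cosh x| <= E.
  by move=> xk; apply: (le_trans (norm_cosh_le xk)); rewrite -/D.
exists (2 * E ^+ 6); first by rewrite mulr_ge0 // exprn_ge0.
move=> c12 c13 c14 c23 c24 c34 h12 h13 h14 h23 h24 h34.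
have m2 x y a b c d : `|x| <= k -> `|y| <= k ->
    `|a| <= E -> `|b| <= E -> `|c| <= E -> `|d| <= E ->
    sinh x * sinh y * (a * b * c * d) <= E ^+ 6 * (`|x| * `|y|).
  move=> /sD hx /sD hy; move: (sinh x) (sinh y) hx hy => p q hx hy ha hb hc hd.
  apply: (le_trans (ler_norm _)); rewrite !normrM.
  rewrite (_ : E ^+ 6 * _ = (E * `|x|) * (E * `|y|) * (E * E * E * E)); last by ring.
  by rewrite !ler_pM ?mulr_ge0.
have m3 x y z a b c : `|x| <= k -> `|y| <= k -> `|z| <= k ->
    `|a| <= E -> `|b| <= E -> `|c| <= E ->
    sinh x * sinh y * sinh z * (a * b * c) <= E ^+ 6 * (`|x| * `|y| * `|z|).
  move=> /sD hx /sD hy /sD hz.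
  move: (sinh x) (sinh y) (sinh z) hx hy hz => p q r hx hy hz ha hb hc.
  apply: (le_trans (ler_norm _)); rewrite !normrM.
  rewrite (_ : E ^+ 6 * _ = (E * `|x|) * (E * `|y|) * (E * `|z|) * (E * E * E)); last by ring.
  by rewrite !ler_pM ?mulr_ge0.
have p2 (x y : R) : 0 <= E ^+ 6 * (`|x| * `|y|) by rewrite !mulr_ge0 ?exprn_ge0.
have p3 (x y z : R) : 0 <= E ^+ 6 * (`|x| * `|y| * `|z|) by rewrite !mulr_ge0 ?exprn_ge0.
rewrite /sinh4.
have t1 := m2 _ _ _ _ _ _ h12 h34 (cE _ h13) (cE _ h14) (cE _ h23) (cE _ h24).
have t2 := m2 _ _ _ _ _ _ h13 h24 (cE _ h12) (cE _ h14) (cE _ h23) (cE _ h34).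
have t3 := m2 _ _ _ _ _ _ h14 h23 (cE _ h12) (cE _ h13) (cE _ h24) (cE _ h34).
have t4 := m3 _ _ _ _ _ _ h12 h13 h14 (cE _ h23) (cE _ h24) (cE _ h34).
have t5 := m3 _ _ _ _ _ _ h12 h23 h24 (cE _ h13) (cE _ h14) (cE _ h34).
have t6 := m3 _ _ _ _ _ _ h13 h23 h34 (cE _ h12) (cE _ h14) (cE _ h24).
have t7 := m3 _ _ _ _ _ _ h14 h24 h34 (cE _ h12) (cE _ h13) (cE _ h23).
have t8 := m2 _ _ _ _ _ _ h12 h34 (sE _ h13) (sE _ h14) (sE _ h23) (sE _ h24).
have := p2 c13 c24; have := p2 c14 c23.
have := p3 c12 c13 c14; have := p3 c12 c23 c24; have := p3 c13 c23 c34; have := p3 c14 c24 c34.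
lra.
Qed.

End hyperbolic.

(** * Sums over four vertices *)

Section quadruple_sums.
Context (R : realType) (M : nat).
Implicit Type F : 'I_M -> 'I_M -> 'I_M -> 'I_M -> R.

Definition sum4 F : R := \sum_(i < M) \sum_(j < M) \sum_(k < M) \sum_(l < M) F i j k l.

Lemma eq_sum4 F G : (forall i j k l, F i j k l = G i j k l) -> sum4 F = sum4 G.
Proof. by move=> h; do 4 (apply: eq_bigr => ? _); exact: h. Qed.

Lemma sum4D F G : sum4 (fun i j k l => F i j k l + G i j k l) = sum4 F + sum4 G.
Proof.
rewrite /sum4 -big_split; apply: eq_bigr => i _.
rewrite -big_split; apply: eq_bigr => j _.
rewrite -big_split; apply: eq_bigr => k _.
by rewrite -big_split.
Qed.

Lemma sum4Z a F : sum4 (fun i j k l => a * F i j k l) = a * sum4 F.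
Proof. by rewrite /sum4; do 4 (rewrite mulr_sumr; apply: eq_bigr => ? _). Qed.

Lemma ler_sum4 F G : (forall i j k l, F i j k l <= G i j k l) -> sum4 F <= sum4 G.
Proof. by move=> h; do 4 (apply: ler_sum => ? _); exact: h. Qed.

Lemma sum4_rot F : sum4 F = sum4 (fun l i j k => F i j k l).
Proof.
rewrite /sum4 [RHS]exchange_big; apply: eq_bigr => i _.
rewrite [RHS]exchange_big; apply: eq_bigr => j _.
by rewrite [RHS]exchange_big.
Qed.

Lemma sum4_swap F : sum4 F = sum4 (fun i k j l => F i j k l).
Proof. by rewrite /sum4; apply: eq_bigr => i _; rewrite exchange_big. Qed.

Lemma sum4_pow (f : 'I_M -> R) :
  (\sum_(i < M) f i) ^+ 4 = sum4 (fun i j k l => f i * f j * f k * f l).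
Proof.
have -> : forall x : R, x ^+ 4 = x * (x * (x * x)) by move=> x; ring.
rewrite {1}mulr_suml; apply: eq_bigr => i _.
rewrite mulrCA {1}mulr_suml; apply: eq_bigr => j _.
rewrite mulrA mulrCA {1}mulr_suml; apply: eq_bigr => k _.
by rewrite mulrA mulr_sumr; apply: eq_bigr => l _; ring.
Qed.

Variable (c : 'I_M -> 'I_M -> R) (K : R).
Hypothesis c0 : forall i j, 0 <= c i j.
Hypothesis cK : forall i, \sum_(j < M) c i j <= K.
Hypothesis cC : forall i j, c i j = c j i.

Lemma sum_rows : \sum_(i < M) \sum_(j < M) c i j <= M%:R * K.
Proof.
apply: (@le_trans _ _ (\sum_(i < M) K)); first exact: ler_sum.
by rewrite sumr_const card_ord mulr_natl.
Qed.

Lemma sum4_matching : sum4 (fun i j k l => c i j * c k l) <= (M%:R * K) ^+ 2.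
Proof.
have -> : sum4 (fun i j k l => c i j * c k l) = (\sum_(i < M) \sum_(j < M) c i j) ^+ 2.
  rewrite expr2 mulr_suml; apply: eq_bigr => i _.
  rewrite mulr_suml; apply: eq_bigr => j _.
  by rewrite mulr_sumr; apply: eq_bigr => k _; rewrite mulr_sumr.
have h0 : 0 <= \sum_(i < M) \sum_(j < M) c i j by do 2 (apply: sumr_ge0 => ? _).
by rewrite ler_pXn2r ?nnegrE ?sum_rows // (le_trans h0 sum_rows).
Qed.

Lemma sum4_star : sum4 (fun i j k l => c i j * c i k * c i l) <= M%:R * K ^+ 3.
Proof.
apply: (@le_trans _ _ (\sum_(i < M) K ^+ 3)); last by rewrite sumr_const card_ord mulr_natl.
apply: ler_sum => i _.
have -> : \sum_(j < M) \sum_(k < M) \sum_(l < M) (c i j * c i k * c i l) = (\sum_(j < M) c i j) ^+ 3.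
  have -> : forall x : R, x ^+ 3 = x * (x * x) by move=> x; ring.
  rewrite {1}mulr_suml; apply: eq_bigr => j _.
  rewrite mulrCA {1}mulr_suml; apply: eq_bigr => k _.
  by rewrite mulrA mulr_sumr; apply: eq_bigr => l _; ring.
have h0 : 0 <= \sum_(j < M) c i j by apply: sumr_ge0.
by rewrite ler_pXn2r ?nnegrE // (le_trans h0).
Qed.

(** Relabeling reduces the three matchings to one and the four stars to one. Matchings have two
    components and cost M^2, stars are connected and cost only M. *)
Lemma sum4_graphs :
  sum4 (fun i j k l =>
    (c i j * c k l + c i k * c j l + c i l * c j k) +
    (c i j * c i k * c i l + c i j * c j k * c j l +
     c i k * c j k * c k l + c i l * c j l * c k l)) <=
  3 * (M%:R * K) ^+ 2 + 4 * (M%:R * K ^+ 3).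
Proof.
rewrite !sum4D.
have -> : sum4 (fun i j k l => c i k * c j l) = sum4 (fun i j k l => c i j * c k l).
  by rewrite sum4_swap.
have -> : sum4 (fun i j k l => c i l * c j k) = sum4 (fun i j k l => c i j * c k l).
  by rewrite sum4_rot; apply: eq_sum4 => i j k l; rewrite (cC j i).
have s3 : sum4 (fun i j k l => c i l * c j l * c k l) = sum4 (fun i j k l => c i j * c i k * c i l).
  by rewrite sum4_rot; apply: eq_sum4 => i j k l; rewrite !(cC _ i).
have s2 : sum4 (fun i j k l => c i k * c j k * c k l) = sum4 (fun i j k l => c i j * c i k * c i l).
  by rewrite 2!sum4_rot; apply: eq_sum4 => i j k l; rewrite !(cC _ i); ring.
have s1 : sum4 (fun i j k l => c i j * c j k * c j l) = sum4 (fun i j k l => c i j * c i k * c i l).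
  by rewrite 3!sum4_rot; apply: eq_sum4 => i j k l; rewrite !(cC _ i); ring.
rewrite s1 s2 s3; have := sum4_matching; have := sum4_star; lra.
Qed.

End quadruple_sums.

Definition edges (R : comPzRingType) (p12 p13 p14 p23 p24 p34 s12 s13 s14 s23 s24 s34 : R)
    (e12 e13 e14 e23 e24 e34 : R) : R :=
  (p12 + e12 * s12) * (p13 + e13 * s13) * (p14 + e14 * s14) *
  ((p23 + e23 * s23) * (p24 + e24 * s24) * (p34 + e34 * s34)).

(* The eight sign patterns are e_i e_j for (e_1, ..., e_4) in {1, -1} ^ 4 up to a
   global sign, weighted by e_1 e_2 e_3 e_4: each vertex of odd degree survives. *)
Lemma edges_signs (R : comPzRingType) (p12 p13 p14 p23 p24 p34 s12 s13 s14 s23 s24 s34 : R) :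
  let F := edges p12 p13 p14 p23 p24 p34 s12 s13 s14 s23 s24 s34 in
  F 1 1 1 1 1 1 - F 1 1 (-1) 1 (-1) (-1) - F 1 (-1) 1 (-1) 1 (-1) - F (-1) 1 1 (-1) (-1) 1
  - F (-1) (-1) (-1) 1 1 1 + F 1 (-1) (-1) (-1) (-1) 1 + F (-1) 1 (-1) (-1) 1 (-1)
  + F (-1) (-1) 1 1 (-1) (-1) =
  8 * (s12 * s34 * (p13 * p14 * p23 * p24) +
  s13 * s24 * (p12 * p14 * p23 * p34) +
  s14 * s23 * (p12 * p13 * p24 * p34) +
  s12 * s13 * s14 * (p23 * p24 * p34) +
  s12 * s23 * s24 * (p13 * p14 * p34) +
  s13 * s23 * s34 * (p12 * p14 * p24) +
  s14 * s24 * s34 * (p12 * p13 * p23) +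
  s12 * s34 * (s13 * s14 * s23 * s24)).
Proof. by move=> F; rewrite /F /edges; ring. Qed.

(** * Moments of normalized hyperbolic sines *)

Section weighted_sinh.
Context d (Omega : measurableType d) (R : realType) (P : probability Omega R).
Variable X : R -> {RV P >-> R}.
Hypothesis gX : gaussian_process X.
Hypothesis cX : forall t : R, 0 <= t -> ('E_P[X t] = 0)%E.
Local Notation gspan := (gspan X).
Local Notation cov := (cov P).

(** The odd part of the Wick exponential exp(B - Var B / 2), which generates the Hermite polynomials
    of odd degree. The normalization removes all variances from the means of products. *)
Definition wsinh (B : Omega -> R) (w : Omega) : R :=
  expR (- (cov B B / 2)) * sinh (B w).

Lemma covDD A B C D : gspan A -> gspan B -> gspan C -> gspan D ->
  cov (fun w => A w + B w) (fun w => C w + D w) =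
  cov A C + cov A D + (cov B C + cov B D).
Proof. by move=> *; rewrite (covDl gX) ?(covDr gX) //; exact: gspanD. Qed.

Lemma mean_expR4 B1 B2 B3 B4 e1 e2 e3 e4 :
  gspan B1 -> gspan B2 -> gspan B3 -> gspan B4 ->
  e1 * e1 = 1 -> e2 * e2 = 1 -> e3 * e3 = 1 -> e4 * e4 = 1 ->
  has_mean P (fun w => expR (e1 * B1 w) * expR (e2 * B2 w) * (expR (e3 * B3 w) * expR (e4 * B4 w)))
   (expR (cov B1 B1 / 2) * expR (cov B2 B2 / 2) * (expR (cov B3 B3 / 2) * expR (cov B4 B4 / 2)) *
    (expR (e1 * e2 * cov B1 B2) * expR (e1 * e3 * cov B1 B3) * expR (e1 * e4 * cov B1 B4) *
     (expR (e2 * e3 * cov B2 B3) * expR (e2 * e4 * cov B2 B4) * expR (e3 * e4 * cov B3 B4)))).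
Proof.
move=> g1 g2 g3 g4 h1 h2 h3 h4.
have z1 := gspanZ e1 g1; have z2 := gspanZ e2 g2; have z3 := gspanZ e3 g3; have z4 := gspanZ e4 g4.
have d12 := gspanD z1 z2; have d34 := gspanD z3 z4.
apply: (has_mean_subst (gspan_mgf gX cX 1 (gspanD d12 d34))) => [w|].
  by rewrite mul1r !expRD.
rewrite -!expRD; congr expR.
rewrite !covDD //.
rewrite !(covZl gX, covZr gX) //.
rewrite (covC _ B2 B1) (covC _ B3 B1) (covC _ B4 B1) (covC _ B3 B2) (covC _ B4 B2) (covC _ B4 B3).
rewrite !(mulrA e1 e1) !(mulrA e2 e2) !(mulrA e3 e3) !(mulrA e4 e4) h1 h2 h3 h4.
by field.
Qed.

(** Each of the sixteen signed exponentials has a mean that factors over the six edges, with exp(e_i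
    e_j c) = cosh c + e_i e_j sinh c. Opposite sign vectors give the same value, so the sum is twice
    the one in [edges_signs], and 2 * 8 cancels the 16 from the four halves. *)
Lemma mean_wsinh4 B1 B2 B3 B4 :
  gspan B1 -> gspan B2 -> gspan B3 -> gspan B4 ->
  has_mean P (fun w => wsinh B1 w * wsinh B2 w * wsinh B3 w * wsinh B4 w)
   (sinh4 (cov B1 B2) (cov B1 B3) (cov B1 B4) (cov B2 B3) (cov B2 B4) (cov B3 B4)).
Proof.
move=> g1 g2 g3 g4.
have o1 : 1 * 1 = 1 :> R by rewrite mul1r.
have o2 : -1 * -1 = 1 :> R by rewrite mulN1r opprK.
pose T e1 e2 e3 e4 := fun w => expR (e1 * B1 w) * expR (e2 * B2 w) * (expR (e3 * B3 w) * expR (e4 * B4 w)).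
pose V e1 e2 e3 e4 := (expR (cov B1 B1 / 2) * expR (cov B2 B2 / 2) * (expR (cov B3 B3 / 2) * expR (cov B4 B4 / 2)) *
    (expR (e1 * e2 * cov B1 B2) * expR (e1 * e3 * cov B1 B3) * expR (e1 * e4 * cov B1 B4) *
     (expR (e2 * e3 * cov B2 B3) * expR (e2 * e4 * cov B2 B4) * expR (e3 * e4 * cov B3 B4)))).
have hT e1 e2 e3 e4 : e1 * e1 = 1 -> e2 * e2 = 1 -> e3 * e3 = 1 -> e4 * e4 = 1 ->
   has_mean P (T e1 e2 e3 e4) (V e1 e2 e3 e4) by exact: mean_expR4.
have h3 e1 e2 e3 : e1 * e1 = 1 -> e2 * e2 = 1 -> e3 * e3 = 1 ->
    has_mean P (fun w => T e1 e2 e3 1 w - T e1 e2 e3 (-1) w) (V e1 e2 e3 1 - V e1 e2 e3 (-1)).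
  by move=> k1 k2 k3; exact: has_meanB (hT _ _ _ _ k1 k2 k3 o1) (hT _ _ _ _ k1 k2 k3 o2).
have h2 e1 e2 : e1 * e1 = 1 -> e2 * e2 = 1 -> has_mean P _ _ :=
  fun k1 k2 => has_meanB (h3 e1 e2 1 k1 k2 o1) (h3 e1 e2 (-1) k1 k2 o2).
have h1 e1 : e1 * e1 = 1 -> has_mean P _ _ :=
  fun k1 => has_meanB (h2 e1 1 k1 o1) (h2 e1 (-1) k1 o2).
have h0 := has_meanB (h1 1 o1) (h1 (-1) o2).
pose c := expR (- (cov B1 B1 / 2)) * expR (- (cov B2 B2 / 2)) *
  (expR (- (cov B3 B3 / 2)) * expR (- (cov B4 B4 / 2))).
apply: (has_mean_subst (has_meanZ (c / 16) h0)) => [w|].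
  by rewrite /T /wsinh /sinh !mul1r !mulN1r /c; field.
have cE : c * (expR (cov B1 B1 / 2) * expR (cov B2 B2 / 2) *
    (expR (cov B3 B3 / 2) * expR (cov B4 B4 / 2))) = 1.
  by rewrite /c -!expRD -expR0; congr expR; ring.
have := edges_signs (cosh (cov B1 B2)) (cosh (cov B1 B3)) (cosh (cov B1 B4))
  (cosh (cov B2 B3)) (cosh (cov B2 B4)) (cosh (cov B3 B4)) (sinh (cov B1 B2)) (sinh (cov B1 B3))
  (sinh (cov B1 B4)) (sinh (cov B2 B3)) (sinh (cov B2 B4)) (sinh (cov B3 B4)).
move=> /=; set F := edges _ _ _ _ _ _ _ _ _ _ _ _ => key.
have expE e x : e * e = 1 :> R -> expR (e * x) = cosh x + e * sinh x.
  move=> /eqP; rewrite -expr2 sqrf_eq1 => /orP[]/eqP ->.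
    by rewrite !mul1r expR_cosh_sinh.
  by rewrite !mulN1r expRN_cosh_sinh.
have VE e1 e2 e3 e4 : e1 * e1 = 1 -> e2 * e2 = 1 -> e3 * e3 = 1 -> e4 * e4 = 1 ->
    c * V e1 e2 e3 e4 = F (e1 * e2) (e1 * e3) (e1 * e4) (e2 * e3) (e2 * e4) (e3 * e4).
  move=> k1 k2 k3 k4; rewrite /V mulrA cE mul1r.
  by rewrite !expE // mulrACA ?k1 ?k2 ?k3 ?k4 mul1r.
rewrite mulrAC !mulrBr.
rewrite (VE 1 1 1 1) // (VE 1 1 1 (-1)) // (VE 1 1 (-1) 1) // (VE 1 1 (-1) (-1)) //.
rewrite (VE 1 (-1) 1 1) // (VE 1 (-1) 1 (-1)) // (VE 1 (-1) (-1) 1) // (VE 1 (-1) (-1) (-1)) //.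
rewrite (VE (-1) 1 1 1) // (VE (-1) 1 1 (-1)) // (VE (-1) 1 (-1) 1) // (VE (-1) 1 (-1) (-1)) //.
rewrite (VE (-1) (-1) 1 1) // (VE (-1) (-1) 1 (-1)) // (VE (-1) (-1) (-1) 1) // (VE (-1) (-1) (-1) (-1)) //.
rewrite !(mulr1, mulrN1, opprK).
apply: (@mulfI _ 8); first by rewrite pnatr_eq0.
by rewrite /sinh4 -key; clearbody F; field.
Qed.

Lemma mean_cube_wsinh A B : gspan A -> gspan B ->
  has_mean P (fun w => A w ^+ 3 * wsinh B w)
    (3 * cov A A * cov A B + cov A B ^+ 3).
Proof.
move=> gA gB; have gN := gspanN gB.
have h := has_meanB (gspan_cube_exp gX cX gA gB) (gspan_cube_exp gX cX gA gN).
apply: (has_mean_subst (has_meanZ (expR (- (cov B B / 2)) / 2) h)) => [w|].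
  by rewrite /wsinh /sinh; field.
have -> : cov (fun w => - B w) (fun w => - B w) = cov B B.
  by rewrite (covNl gX) // (covNr gX) // opprK.
rewrite (covNr gX) //.
have e1 : expR (- (cov B B / 2)) * expR (cov B B / 2) = 1.
  by rewrite mulrC expRxMexpNx_1.
rewrite -!mulrBr mulrACA.
by rewrite e1 mul1r; field.
Qed.

Lemma mean_wsinh_sum_pow4 k : exists2 C, 0 <= C & forall M (B : 'I_M -> Omega -> R) K,
  (forall i, gspan (B i)) -> (forall i j, `|cov (B i) (B j)| <= k) ->
  (forall i, \sum_(j < M) `|cov (B i) (B j)| <= K) ->
  exists2 v, has_mean P (fun w => (\sum_(i < M) wsinh (B i) w) ^+ 4) v &
    v <= C * (3 * (M%:R * K) ^+ 2 + 4 * (M%:R * K ^+ 3)).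
Proof.
have [C C0 hC] := norm_sinh4_le k; exists C => // M B K gB hk hK.
exists (sum4 (fun i j l m => sinh4 (cov (B i) (B j)) (cov (B i) (B l)) (cov (B i) (B m))
    (cov (B j) (B l)) (cov (B j) (B m)) (cov (B l) (B m)))).
  apply: (@eq_has_mean _ _ _ _ (fun w => sum4 (fun i j l m =>
      wsinh (B i) w * wsinh (B j) w * wsinh (B l) w * wsinh (B m) w))) => [w|].
    by rewrite sum4_pow.
  apply: has_mean_sum => i _; apply: has_mean_sum => j _.
  apply: has_mean_sum => l _; apply: has_mean_sum => m _.
  exact: mean_wsinh4.
apply: le_trans (ler_wpM2l C0 (@sum4_graphs _ _ (fun i j => `|cov (B i) (B j)|) K _ hK _)) => //.
  by rewrite -sum4Z; apply: ler_sum4 => i j l m; exact: hC.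
by move=> i j; rewrite covC.
Qed.

End weighted_sinh.

Lemma sum_const_ord (R : pzRingType) n (c : R) : \sum_(i < n) c = n%:R * c.
Proof. by rewrite sumr_const card_ord mulr_natl. Qed.

(** * Riemann sums and test variables of the fractional Brownian motion *)

Section fbm_moments.
Context d (Omega : measurableType d) (R : realType) (P : probability Omega R).
Variable X : R -> {RV P >-> R}.
Hypothesis hX : fractional_brownian_motion (1 / 6) X.
Let gX := fbm_gaussian hX.
Let cX := fbm_centered hX.
Local Notation gspan := (gspan X).
Local Notation cov := (cov P).

Definition incr (h s : R) (w : Omega) : R := X (s + h) w - X s w.

Lemma gspan_incr h s : 0 <= h -> 0 <= s -> gspan (incr h s).
Proof. by move=> h0 s0; apply: gspanB; apply: gspan_X; rewrite ?addr_ge0. Qed.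

Lemma var_diff s t : 0 <= s -> 0 <= t ->
  cov (fun w => X t w - X s w) (fun w => X t w - X s w) = rt3 (t - s).
Proof.
move=> s0 t0.
have g := gspan_sq gX (gspanB (gspan_X X t0) (gspan_X X s0)).
have := fbm_increments hX s0 t0.
have -> : (2 * (1 / 6) : R) = 3^-1 by field.
rewrite unlock => e.
rewrite -(g.2) /Rintegral.
have -> : (fun w => ((X t w - X s w) * (X t w - X s w))%:E) =
          (EFin \o (fun w => (X t w - X s w) ^+ 2)).
  by apply/funext => w /=; rewrite expr2.
by rewrite e.
Qed.

(** Polarization: twice the product of the two increments is a signed sum of four squared
    increments. *)
Lemma cov_diff s s' t t' : 0 <= s -> 0 <= s' -> 0 <= t -> 0 <= t' ->
  cov (fun w => X s' w - X s w) (fun w => X t' w - X t w) =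
  (rt3 (s' - t) + rt3 (s - t') - rt3 (s' - t') - rt3 (s - t)) / 2.
Proof.
move=> s0 s'0 t0 t'0.
have g u v : 0 <= u -> 0 <= v -> has_mean P (fun w => (X u w - X v w) * (X u w - X v w)) (rt3 (u - v)).
  move=> u0 v0; rewrite -var_diff //.
  exact: (gspan_sq gX (gspanB (gspan_X X u0) (gspan_X X v0))).
have m := has_meanB (has_meanB (has_meanD (g _ _ s'0 t0) (g _ _ s0 t'0)) (g _ _ s'0 t'0)) (g _ _ s0 t0).
apply: has_mean_unique (gspan_mul gX (gspanB (gspan_X X s'0) (gspan_X X s0)) (gspanB (gspan_X X t'0) (gspan_X X t0))) _.
apply: (has_mean_subst (has_meanZ 2^-1 m)) => [w|]; first by field.
by rewrite mulrC.
Qed.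

Lemma cov_incr e x y : 0 <= e -> 0 <= x -> 0 <= y ->
  cov (incr e (x * e)) (incr e (y * e)) = rt3 e * rtD2 (x - y) / 2.
Proof.
move=> e0 x0 y0; rewrite /incr cov_diff ?addr_ge0 ?mulr_ge0 //.
have -> : x * e + e - y * e = e * (x - y + 1) by ring.
have -> : x * e - (y * e + e) = e * (x - y - 1) by ring.
have -> : x * e + e - (y * e + e) = e * (x - y) by ring.
have -> : x * e - y * e = e * (x - y) by ring.
by rewrite !rt3M rtD2E; ring.
Qed.

Lemma var_incr e s : 0 <= e -> 0 <= s -> cov (incr e s) (incr e s) = rt3 e.
Proof.
move=> e0 s0; rewrite /incr var_diff ?addr_ge0 //.
by congr rt3; ring.
Qed.

(* The Riemann sum with mesh T / (N q) of [cubic_variation X T (T / N)], whose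
   nodes (i + r / q) (T / N) are grouped by their offset r / q. *)
Definition riem (N q : nat) (T : R) (w : Omega) : R :=
  q%:R^-1 * \sum_(r < q) \sum_(i < N)
    incr (T / N%:R) ((i%:R + r%:R / q%:R) * (T / N%:R)) w ^+ 3.

(* For the terms of lag x the product of cubes has mean
   rt3 e ^ 3 * (9/2 D + 3/4 D ^ 3) with D = rtD2 x, and rt3 e ^ 3 = e: this is
   where H = 1 / 6 makes the normalization critical. *)
Lemma mean_riem_sq N q T : (0 < N)%N -> (0 < q)%N -> 0 < T ->
  exists2 v, has_mean P (fun w => riem N q T w ^+ 2) v & v <= 45 * T.
Proof.
move=> N0 q0 T0; set e := T / N%:R.
have NR : 0 < N%:R :> R by rewrite ltr0n.
have qR : 0 < q%:R :> R by rewrite ltr0n.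
have e0 : 0 <= e by rewrite divr_ge0 // ltW.
pose x (r : 'I_q) (i : 'I_N) : R := i%:R + r%:R / q%:R.
have x0 r i : 0 <= x r i by rewrite addr_ge0 // divr_ge0.
pose A r i := incr e (x r i * e).
have gA r i : gspan (A r i) by apply: gspan_incr => //; rewrite mulr_ge0.
pose v r i r' i' := 9 * cov (A r i) (A r i) * cov (A r' i') (A r' i') * cov (A r i) (A r' i') + 6 * cov (A r i) (A r' i') ^+ 3.
exists (q%:R^-1 ^+ 2 * \sum_(r < q) \sum_(r' < q) \sum_(i < N) \sum_(i' < N) v r i r' i').
  apply: (@eq_has_mean _ _ _ _ (fun w => q%:R^-1 ^+ 2 * \sum_(r < q) \sum_(r' < q) \sum_(i < N) \sum_(i' < N) (A r i w ^+ 3 * A r' i' w ^+ 3))) => [w|].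
    rewrite /riem exprMn; congr (_ * _).
    rewrite [RHS]expr2 mulr_suml; apply: eq_bigr => r _.
    rewrite mulr_sumr; apply: eq_bigr => r' _.
    rewrite mulr_suml; apply: eq_bigr => i _.
    by rewrite mulr_sumr.
  apply: has_meanZ; apply: has_mean_sum => r _; apply: has_mean_sum => r' _.
  apply: has_mean_sum => i _; apply: has_mean_sum => i' _.
  exact: (gspan_cube_cube gX cX (gA r i) (gA r' i')).
(* Since |D| <= 2, 9/2 |D| + 3/4 |D|^3 is at most 15/2 |D|. A row then costs 6 * 15/2 = 45 times
   e. *)
have vb r i r' i' : v r i r' i' <= 15 / 2 * e * `|rtD2 (x r i - x r' i')|.
  have s0 r1 i1 : 0 <= x r1 i1 * e by rewrite mulr_ge0.
  rewrite /v /A (var_incr e0 (s0 r i)) (var_incr e0 (s0 r' i')) (cov_incr e0 (x0 r i) (x0 r' i')).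
  set D := rtD2 _; have D2 : `|D| <= 2 := rtD2_le2 _.
  rewrite (_ : 9 * _ * _ * _ + _ = rt3 e ^+ 3 * (9 / 2 * D + 3 / 4 * D ^+ 3)); last by field.
  have e3 : rt3 e ^+ 3 = e by rewrite rt3_cube ger0_norm.
  rewrite e3 (_ : 15 / 2 * e * _ = e * (15 / 2 * `|D|)); last by ring.
  apply: ler_wpM2l => //.
  have D3 : D ^+ 3 <= 4 * `|D|.
    rewrite (le_trans (ler_norm _)) // normrX exprSr ler_wpM2r //.
    by have := normr_ge0 D; nra.
  have := ler_norm D; lra.
have row r i r' : \sum_(i' < N) v r i r' i' <= 45 * e.
  apply: (@le_trans _ _ (\sum_(i' < N) 15 / 2 * e * `|rtD2 (i%:R + r%:R / q%:R - r'%:R / q%:R - i'%:R)|)).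
    apply: ler_sum => i' _; apply: le_trans (vb _ _ _ _) _.
    rewrite le_eqVlt; apply/orP; left; apply/eqP; congr (_ * `|rtD2 _|).
    by rewrite /x; ring.
  rewrite -mulr_sumr.
  have := sum_rtD2_rev (i%:R + r%:R / q%:R - r'%:R / q%:R : R) N; nra.
have -> : 45 * T = q%:R^-1 ^+ 2 * \sum_(r < q) \sum_(r' < q) \sum_(i < N) (45 * e).
  rewrite !sum_const_ord /e; field.
  by rewrite !gt_eqF.
rewrite ler_wpM2l ?sqr_ge0 //.
by do 2 (apply: ler_sum => ? _); apply: ler_sum => i _; exact: row.
Qed.

Section test_variables.
Variable e : R.
Hypothesis e0 : 0 < e.
Let tau := Num.sqrt (rt3 e).

Lemma rt3_gt0 x : 0 < x -> 0 < rt3 x :> R.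
Proof. by move=> x0; rewrite /rt3 powR_gt0 // normr_gt0 gt_eqF. Qed.

Let tau0 : 0 < tau. Proof. by rewrite sqrtr_gt0 rt3_gt0. Qed.
Let tau2 : tau ^+ 2 = rt3 e. Proof. by rewrite sqr_sqrtr // rt3_ge0. Qed.

Definition winc (k : nat) (w : Omega) : R := (Num.sqrt (rt3 e))^-1 * incr e (k%:R * e) w.

Lemma gspan_winc k : gspan (winc k).
Proof. by apply: gspanZ; apply: gspan_incr; rewrite ?mulr_ge0 // ltW. Qed.

Lemma cov_winc k l : cov (winc k) (winc l) = rtD2 (k%:R - l%:R) / 2.
Proof.
have e0' := ltW e0.
rewrite /winc -/tau (covZl gX) ?(covZr gX) //; try by [apply: gspan_incr; rewrite ?mulr_ge0|apply: gspanZ; apply: gspan_incr; rewrite ?mulr_ge0].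
by rewrite cov_incr // -tau2; field; rewrite gt_eqF.
Qed.

(** The pattern [s] lists coefficients with shifts, and j translates it; bounds in terms of [wt s]
    are thus uniform in e and j. *)
Definition tvar (s : seq (R * nat)) (j : nat) (w : Omega) : R :=
  \sum_(p <- s) p.1 * winc (j + p.2) w.

Definition wt (s : seq (R * nat)) : R := \sum_(p <- s) `|p.1|.

Lemma wt_ge0 s : 0 <= wt s. Proof. exact: sumr_ge0. Qed.

Lemma gspan_tvar s j : gspan (tvar s j).
Proof. by apply: gspan_sum => p _; apply: gspanZ; exact: gspan_winc. Qed.

Lemma cov_tvarl s j A : gspan A ->
  cov (tvar s j) A = \sum_(p <- s) p.1 * cov (winc (j + p.2)) A.
Proof.
move=> gA; rewrite /tvar (cov_suml gX) //; last by move=> p; apply: gspanZ; exact: gspan_winc.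
by apply: eq_bigr => p _; rewrite (covZl gX) //; exact: gspan_winc.
Qed.

Lemma cov_tvarr s j A : gspan A ->
  cov A (tvar s j) = \sum_(p <- s) p.1 * cov A (winc (j + p.2)).
Proof. by move=> gA; rewrite covC cov_tvarl //; apply: eq_bigr => p _; rewrite covC. Qed.

Lemma cov_tvar s i j : cov (tvar s i) (tvar s j) =
  \sum_(p <- s) \sum_(q <- s) p.1 * q.1 * (rtD2 (i%:R + p.2%:R - j%:R - q.2%:R) / 2).
Proof.
rewrite cov_tvarl; last exact: gspan_tvar.
apply: eq_bigr => p _; rewrite cov_tvarr; last exact: gspan_winc.
rewrite mulr_sumr; apply: eq_bigr => q _; rewrite mulrA cov_winc; congr (_ * (rtD2 _ / 2)).
by rewrite !natrD; ring.
Qed.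

Lemma wt_sqr s : \sum_(p <- s) \sum_(q <- s) `|p.1| * `|q.1| = wt s ^+ 2.
Proof. by rewrite expr2 /wt mulr_suml; apply: eq_bigr => p _; rewrite mulr_sumr. Qed.

Lemma norm_cov_tvar s i j : `|cov (tvar s i) (tvar s j)| <=
  \sum_(p <- s) \sum_(q <- s) `|p.1| * `|q.1| * (`|rtD2 (i%:R + p.2%:R - j%:R - q.2%:R)| / 2).
Proof.
rewrite cov_tvar; apply: le_trans (ler_norm_sum _ _ _) _; apply: ler_sum => p _.
apply: le_trans (ler_norm_sum _ _ _) _; apply: ler_sum => q _.
by rewrite !normrM (ger0_norm (_ : 0 <= 2^-1)) // invr_ge0.
Qed.

Lemma norm_cov_tvar_le s i j : `|cov (tvar s i) (tvar s j)| <= wt s ^+ 2.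
Proof.
apply: le_trans (norm_cov_tvar s i j) _; rewrite -wt_sqr.
apply: ler_sum => p _; apply: ler_sum => q _; rewrite ler_piMr ?mulr_ge0 //.
by have := rtD2_le2 (i%:R + p.2%:R - j%:R - q.2%:R : R); lra.
Qed.

Lemma sum_norm_cov_tvar_le s i M : \sum_(j < M) `|cov (tvar s i) (tvar s j)| <= 3 * wt s ^+ 2.
Proof.
apply: le_trans; first by apply: ler_sum => j _; exact: norm_cov_tvar.
rewrite exchange_big /= -wt_sqr mulr_sumr; apply: ler_sum => p _.
rewrite exchange_big /= mulr_sumr; apply: ler_sum => q _.
rewrite -mulr_sumr mulrC ler_wpM2r ?mulr_ge0 // -mulr_suml.
have := sum_rtD2_rev (i%:R + p.2%:R - q.2%:R : R) M.
rewrite (eq_bigr (fun j : 'I_M => `|rtD2 (i%:R + p.2%:R - j%:R - q.2%:R : R)|)); first by lra.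
by move=> j _; congr `|rtD2 _|; ring.
Qed.

Definition win3 (L : nat) : seq (R * nat) := [seq (1, k) | k <- iota 0 (2 * L)].
(** Three increments rather than one: the correlation [rtD2 u / 2] of a single increment with one at
    offset u vanishes for some u in (0, 1), whereas the sum of three keeps a covariance bounded
    below for all offsets. *)
Definition win1 (L : nat) : seq (R * nat) := [seq (1, k) | k <- iota L.-1 3].
Definition wneg (s : seq (R * nat)) : seq (R * nat) := [seq (- p.1, p.2) | p <- s].

Lemma tvar_cat s s' j w : tvar (s ++ s') j w = tvar s j w + tvar s' j w.
Proof. by rewrite /tvar big_cat. Qed.

Lemma tvar_neg s j w : tvar (wneg s) j w = - tvar s j w.
Proof. by rewrite /tvar big_map -sumrN; apply: eq_bigr => p _; rewrite mulNr. Qed.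

(* The second difference in the direction [win1] cancels the part of
   E[A ^ 3 wsinh B] that is linear in cov A B. *)
Definition test (L j : nat) (w : Omega) : R :=
  wsinh P (tvar (win3 L ++ win1 L) j) w + wsinh P (tvar (win3 L ++ wneg (win1 L)) j) w
  - 2 * wsinh P (tvar (win3 L) j) w.

(** After cancellation of the linear part, (a + b)^3 + (a - b)^3 - 2 a^3 = 6 a b^2. *)
Lemma mean_cube_test L j A : gspan A ->
  has_mean P (fun w => A w ^+ 3 * test L j w)
    (6 * cov A (tvar (win3 L) j) * cov A (tvar (win1 L) j) ^+ 2).
Proof.
move=> gA.
have m s := mean_cube_wsinh gX cX gA (gspan_tvar s j).
have h := has_meanB (has_meanD (m (win3 L ++ win1 L)) (m (win3 L ++ wneg (win1 L)))) (has_meanZ 2 (m (win3 L))).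
apply: (has_mean_subst h) => [w|]; first by rewrite /test; ring.
have e1 : cov A (tvar (win3 L ++ win1 L) j) = cov A (tvar (win3 L) j) + cov A (tvar (win1 L) j).
  rewrite -(covDr gX) //; try exact: gspan_tvar.
  by congr cov; apply/funext => w; rewrite tvar_cat.
have e2 : cov A (tvar (win3 L ++ wneg (win1 L)) j) = cov A (tvar (win3 L) j) - cov A (tvar (win1 L) j).
  rewrite -(covBr gX) //; try exact: gspan_tvar.
  by congr cov; apply/funext => w; rewrite tvar_cat tvar_neg.
by rewrite e1 e2; ring.
Qed.

(** The prefactor is e^(1/2), written tau^3 with tau = [sqrt (rt3 e)]: each of the three covariances
    with an increment of length e brings another tau, and tau^6 = e. *)
Definition gfun (L M : nat) (w : Omega) : R :=
  Num.sqrt (rt3 e) ^+ 3 * \sum_(j < M) test L j w.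

Lemma cov_incr_winc x k : 0 <= x ->
  cov (incr e (x * e)) (winc k) = tau * rtD2 (x - k%:R) / 2.
Proof.
move=> x0; have e0' := ltW e0.
rewrite /winc -/tau (covZr gX) //; try by apply: gspan_incr; rewrite ?mulr_ge0.
by rewrite cov_incr // -tau2; field; rewrite gt_eqF.
Qed.

Lemma sum_rtD2_iota (y : R) m n :
  \sum_(k <- iota m n) rtD2 (y - k%:R) = rtD (y - m%:R) - rtD (y - (m + n)%:R).
Proof.
elim: n m => [|n ih] m; first by rewrite big_nil addn0 subrr.
rewrite /= big_cons ih /rtD2 addSnnS.
have -> : y - m%:R - 1 = y - m.+1%:R by rewrite -natr1; ring.
by ring.
Qed.

Lemma cov_incr_tvar x j m n : 0 <= x ->
  cov (incr e (x * e)) (tvar [seq (1, k) | k <- iota m n] j) =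
  tau / 2 * (rtD (x - j%:R - m%:R) - rtD (x - j%:R - (m + n)%:R)).
Proof.
move=> x0; rewrite cov_tvarr; last by apply: gspan_incr; rewrite ?mulr_ge0 // ltW.
rewrite big_map -sum_rtD2_iota mulr_sumr; apply: eq_bigr => k _ /=.
rewrite mul1r cov_incr_winc // natrD.
have -> : x - (j%:R + k%:R) = x - j%:R - k%:R by ring.
by ring.
Qed.

Lemma cov_incr_win3 L x j : 0 <= x ->
  cov (incr e (x * e)) (tvar (win3 L) j) = tau / 2 * ker3 L (x - j%:R).
Proof. by move=> x0; rewrite cov_incr_tvar // /ker3 subr0 add0n. Qed.

Lemma cov_incr_win1 L x j : (0 < L)%N -> 0 <= x ->
  cov (incr e (x * e)) (tvar (win1 L) j) = tau / 2 * ker1 L (x - j%:R).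
Proof.
case: L => // L _ x0; rewrite cov_incr_tvar // /ker1 /= -natr1 natrD.
congr (_ * (rtD _ - rtD _)); ring.
Qed.

End test_variables.

(** By convexity, (x + y - 2 z)^4 <= 27 (x^4 + y^4 + 16 z^4), where x, y, z are the sums of the
    three kinds of hyperbolic sines. The majorant has a mean given by [mean_wsinh_sum_pow4], and the
    star term, of order M, is absorbed into M^2. *)
Lemma mean_gfun_pow4 L : exists2 C, 0 <= C & forall e M, 0 < e -> (0 < M)%N ->
  exists (U : Omega -> R) u, [/\ has_mean P U u, u <= C * (e * M%:R) ^+ 2 &
    forall w, gfun e L M w ^+ 4 <= U w].
Proof.
pose sa := win3 L ++ win1 L; pose sb := win3 L ++ wneg (win1 L); pose sc := win3 L.
have [Ca Ca0 ha] := mean_wsinh_sum_pow4 gX cX (wt sa ^+ 2).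
have [Cb Cb0 hb] := mean_wsinh_sum_pow4 gX cX (wt sb ^+ 2).
have [Cc Cc0 hc] := mean_wsinh_sum_pow4 gX cX (wt sc ^+ 2).
pose q (s : seq (R * nat)) := 3 * (3 * wt s ^+ 2) ^+ 2 + 4 * (3 * wt s ^+ 2) ^+ 3.
have z0 s : 0 <= 3 * wt s ^+ 2 by rewrite mulr_ge0 // sqr_ge0.
have q0 s : 0 <= q s by rewrite addr_ge0 // mulr_ge0 // exprn_ge0.
exists (27 * (Ca * q sa + Cb * q sb + 16 * (Cc * q sc))).
  by rewrite mulr_ge0 // !addr_ge0 // !mulr_ge0.
move=> e M e0 M0.
have M1 : 1 <= M%:R :> R by rewrite ler1n.
have B s C : 0 <= C -> forall v, v <= C * (3 * (M%:R * (3 * wt s ^+ 2)) ^+ 2 + 4 * (M%:R * (3 * wt s ^+ 2) ^+ 3)) ->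
    v <= C * q s * M%:R ^+ 2.
  move=> C0 v hv; apply: (le_trans hv); rewrite -mulrA ler_wpM2l // /q.
  have : 0 <= (3 * wt s ^+ 2) ^+ 3 by rewrite exprn_ge0 // mulr_ge0 // sqr_ge0.
  move: (3 * wt s ^+ 2) => z z3.
  have : M%:R * z ^+ 3 <= M%:R ^+ 2 * z ^+ 3 by rewrite ler_wpM2r //; nra.
  by nra.
have [va ma /(B _ _ Ca0) la] := ha M (fun i => tvar e sa i) (3 * wt sa ^+ 2) (fun i => gspan_tvar e0 sa i)
  (fun i j => norm_cov_tvar_le e0 sa i j) (fun i => sum_norm_cov_tvar_le e0 sa i M).
have [vb mb /(B _ _ Cb0) lb] := hb M (fun i => tvar e sb i) (3 * wt sb ^+ 2) (fun i => gspan_tvar e0 sb i)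
  (fun i j => norm_cov_tvar_le e0 sb i j) (fun i => sum_norm_cov_tvar_le e0 sb i M).
have [vc mc /(B _ _ Cc0) lc] := hc M (fun i => tvar e sc i) (3 * wt sc ^+ 2) (fun i => gspan_tvar e0 sc i)
  (fun i j => norm_cov_tvar_le e0 sc i j) (fun i => sum_norm_cov_tvar_le e0 sc i M).
have mU := has_meanZ (27 * e ^+ 2) (has_meanD (has_meanD ma mb) (has_meanZ 16 mc)).
exists (fun w => 27 * e ^+ 2 * ((\sum_(i < M) wsinh P (tvar e sa i) w) ^+ 4 + (\sum_(i < M) wsinh P (tvar e sb i) w) ^+ 4 +
   16 * (\sum_(i < M) wsinh P (tvar e sc i) w) ^+ 4)), (27 * e ^+ 2 * (va + vb + 16 * vc)).
split=> //.
  rewrite (_ : _ * (e * _) ^+ 2 = 27 * e ^+ 2 * ((Ca * q sa + Cb * q sb + 16 * (Cc * q sc)) * M%:R ^+ 2)); last by ring.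
  apply: ler_wpM2l; first by rewrite mulr_ge0 // sqr_ge0.
  move: la lb lc; lra.
move=> w; rewrite /gfun exprMn.
have -> : (Num.sqrt (rt3 e) ^+ 3) ^+ 4 = e ^+ 2.
  rewrite -exprM (_ : (3 * 4 = 2 * (3 * 2))%N) // exprM sqr_sqrtr ?rt3_ge0 //.
  by rewrite exprM rt3_cube ger0_norm // ltW.
set S := (X in _ <= _ * X); rewrite (_ : 27 * e ^+ 2 * S = e ^+ 2 * (27 * S)); last by ring.
apply: ler_wpM2l; first exact: sqr_ge0.
rewrite /S /test sumrB big_split /= -mulr_sumr -/sa -/sb -/sc.
move: (\sum_(i < M) _) (\sum_(i < M) _) (\sum_(i < M) _) => z y x.
have s2 (a b c : R) : (a + b + c) ^+ 2 <= 3 * (a ^+ 2 + b ^+ 2 + c ^+ 2).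
  have := sqr_ge0 (a - b); have := sqr_ge0 (b - c); have := sqr_ge0 (a - c); lra.
have h1 := s2 x y (- (2 * z)).
have h2 := s2 (x ^+ 2) (y ^+ 2) ((- (2 * z)) ^+ 2).
have h3 : ((x + y - 2 * z) ^+ 2) ^+ 2 <= (3 * (x ^+ 2 + y ^+ 2 + (- (2 * z)) ^+ 2)) ^+ 2.
  by rewrite ler_pXn2r ?nnegrE ?sqr_ge0 // mulr_ge0 // !addr_ge0 ?sqr_ge0.
lra.
Qed.

Lemma mean_riem_gfun_ge : exists (L : nat) (theta : R), 0 < theta /\
  forall T, 0 < T -> forall M q, (L <= M)%N -> (0 < M)%N -> (0 < q)%N ->
  exists2 v, has_mean P (fun w => riem (2 * M) q T w * gfun (T / (2 * M)%:R) L M w) v &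
    theta * T <= v.
Proof.
have [L [theta [L3 th0 hker]]] := @sum_ker_ge R.
(* Here 3/8 = 6 * 2^(-3) / 2: a factor 6 from [mean_cube_test], a half from each of three
   covariances, and M e = T / 2. *)
exists L, (3 / 8 * theta); split; first by rewrite mulr_gt0 //; lra.
move=> T T0 M q LM M0 q0; set N := (2 * M)%N.
have NR : 0 < N%:R :> R by rewrite ltr0n muln_gt0.
have MR : 0 < M%:R :> R by rewrite ltr0n.
have qR : 0 < q%:R :> R by rewrite ltr0n.
have L0 : (0 < L)%N by apply: leq_trans L3.
set e := T / N%:R; have e0 : 0 < e by rewrite divr_gt0.
pose x (r : 'I_q) (i : 'I_N) : R := i%:R + r%:R / q%:R.
have x0 r i : 0 <= x r i by rewrite addr_ge0 // divr_ge0.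
have gA r i : gspan (incr e (x r i * e)) by apply: gspan_incr; rewrite ?mulr_ge0 // ltW.
pose v r i (j : 'I_M) := 6 * cov (incr e (x r i * e)) (tvar e (win3 L) j) * cov (incr e (x r i * e)) (tvar e (win1 L) j) ^+ 2.
exists (q%:R^-1 * Num.sqrt (rt3 e) ^+ 3 * \sum_(r < q) \sum_(i < N) \sum_(j < M) v r i j).
  apply: (@eq_has_mean _ _ _ _ (fun w => q%:R^-1 * Num.sqrt (rt3 e) ^+ 3 * \sum_(r < q) \sum_(i < N) \sum_(j < M) (incr e (x r i * e) w ^+ 3 * test e L j w))) => [w|].
    rewrite /riem /gfun -/e mulrACA; congr (_ * _).
    rewrite mulr_suml; apply: eq_bigr => r _.
    rewrite mulr_suml; apply: eq_bigr => i _.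
    by rewrite mulr_sumr.
  apply: has_meanZ; apply: has_mean_sum => r _; apply: has_mean_sum => i _.
  by apply: has_mean_sum => j _; exact: mean_cube_test.
set tau := Num.sqrt (rt3 e).
have tau6 : tau ^+ 6 = e.
  have -> : tau ^+ 6 = (tau ^+ 2) ^+ 3 by rewrite -exprM.
  by rewrite sqr_sqrtr ?rt3_ge0 // rt3_cube ger0_norm // ltW.
have row r : M%:R * theta * (3 / 4 * tau ^+ 3) <= \sum_(i < N) \sum_(j < M) v r i j.
  rewrite exchange_big /=.
  have -> : M%:R * theta * (3 / 4 * tau ^+ 3) = \sum_(j < M) theta * (3 / 4 * tau ^+ 3).
    by rewrite sum_const_ord -mulrA.
  apply: ler_sum => j _.
  have u01 : 0 <= (r%:R / q%:R : R) < 1 by rewrite divr_ge0 //= ltr_pdivrMr // mul1r ltr_nat.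
  (* Taking N = 2 M and M >= L keeps the dominant node i = j + L within the range of the Riemann sum
     for every j < M. *)
  have jN : (j + L < N)%N by rewrite /N mul2n -addnn -addSn leq_add.
  have := hker N j _ u01 jN => hk.
  rewrite (eq_bigr (fun i : 'I_N => 3 / 4 * tau ^+ 3 * (ker3 L (r%:R / q%:R + i%:R - j%:R) * ker1 L (r%:R / q%:R + i%:R - j%:R) ^+ 2))); last first.
    move=> i _; rewrite /v cov_incr_win3 // cov_incr_win1 // -/tau /x (addrC i%:R).
    by field.
  rewrite -mulr_sumr mulrC ler_wpM2l // mulr_ge0 ?exprn_ge0 ?sqrtr_ge0 //; lra.
apply: (@le_trans _ _ (q%:R^-1 * tau ^+ 3 * \sum_(r < q) (M%:R * theta * (3 / 4 * tau ^+ 3)))); last first.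
  by rewrite ler_wpM2l ?mulr_ge0 ?invr_ge0 ?exprn_ge0 ?sqrtr_ge0 //; apply: ler_sum => r _; exact: row.
rewrite sum_const_ord.
rewrite (_ : _ * _ * (_ * _) = M%:R * theta * (3 / 4) * tau ^+ 6); last by field; rewrite gt_eqF.
rewrite tau6 /e /N natrM.
rewrite le_eqVlt; apply/orP; left; apply/eqP; field.
by rewrite gt_eqF.
Qed.

(* A signed cube root, whose increments dominate those of [rt3] and telescope. *)
Definition sroot (x : R) : R := if 0 <= x then rt3 x else - rt3 x.

Lemma norm_rt3_sub_le x y : x <= y -> `|rt3 y - rt3 x| <= sroot y - sroot x.
Proof.
move=> xy; rewrite /sroot; have := rt3_ge0 x; have := rt3_ge0 y.
case: (leP 0 x) => x0; case: (leP 0 y) => y0 ry rx; try lra.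
- by rewrite ger0_norm // subr_ge0 ler_rt3 // !ger0_norm.
- by rewrite ler_norml; lra.
- rewrite ler0_norm; first by lra.
  by rewrite subr_le0 ler_rt3 // !ltr0_norm //; lra.
Qed.

Lemma sum_norm_rt3_sub_le (h x : R) n : 0 <= h ->
  \sum_(i < n) `|rt3 (x + i%:R * h + h) - rt3 (x + i%:R * h)| <= rt3 (x + n%:R * h) + rt3 x.
Proof.
move=> h0.
have s y : - rt3 y <= sroot y <= rt3 y.
  by rewrite /sroot; have := rt3_ge0 y; case: ifP; lra.
apply: (@le_trans _ _ (sroot (x + n%:R * h) - sroot x)); last first.
  by have := s x; have := s (x + n%:R * h); lra.
elim: n => [|n ih]; first by rewrite big_ord0 mul0r addr0 subrr.
rewrite big_ord_recr /=.
have -> : x + n.+1%:R * h = x + n%:R * h + h by rewrite -natr1; ring.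
have := @norm_rt3_sub_le (x + n%:R * h) (x + n%:R * h + h).
have -> : x + n%:R * h <= x + n%:R * h + h by rewrite lerDl.
move=> /(_ isT); lra.
Qed.

Lemma norm_cov_incr_winc e h s k : 0 < e -> 0 <= h -> 0 <= s ->
  `|cov (incr h s) (winc e k)| <= (2 * Num.sqrt (rt3 e))^-1 *
    (`|rt3 (s - k%:R * e + h) - rt3 (s - k%:R * e)| +
     `|rt3 (s - k%:R * e - e + h) - rt3 (s - k%:R * e - e)|).
Proof.
move=> e0 h0 s0; have e0' := ltW e0.
have tau0 : 0 < Num.sqrt (rt3 e) by rewrite sqrtr_gt0 rt3_gt0.
rewrite /winc (covZr gX) //; try by apply: gspan_incr; rewrite ?mulr_ge0.
rewrite /incr cov_diff ?addr_ge0 ?mulr_ge0 // normrM ger0_norm ?invr_ge0 ?(ltW tau0) //.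
rewrite invfM (mulrC 2^-1) -mulrA ler_wpM2l ?invr_ge0 ?(ltW tau0) //.
rewrite normrM (ger0_norm (_ : 0 <= 2^-1)) ?invr_ge0 // mulrC ler_wpM2l ?invr_ge0 //.
have -> : s + h - k%:R * e = s - k%:R * e + h by ring.
have -> : s - (k%:R * e + e) = s - k%:R * e - e by ring.
have -> : s + h - (k%:R * e + e) = s - k%:R * e - e + h by ring.
apply: le_trans (ler_normB _ _).
by rewrite le_eqVlt; apply/orP; left; apply/eqP; congr `|_|; ring.
Qed.

(** Of the three covariances in a term, two are O(h^(1/3)) uniformly. The absolute values of the
    third have a bounded sum over i, being controlled by the variation of [rt3] on a bounded
    interval. The total is O(h^(2/3)). *)
Lemma mean_riem_gfun_small e L M T : 0 < e -> 0 < T -> exists2 C, 0 <= C &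
  forall N q, (0 < N)%N -> (0 < q)%N ->
  exists2 v, has_mean P (fun w => riem N q T w * gfun e L M w) v &
    v <= C * rt3 (T / N%:R) ^+ 2.
Proof.
move=> e0 T0; set tau := Num.sqrt (rt3 e).
have tau0 : 0 < tau by rewrite sqrtr_gt0 rt3_gt0.
(* All base points of the telescoping sums lie in [-Q, T], so every argument of [rt3] that survives
   is at most Q + T in absolute value. *)
pose Q := T + (M%:R + (2 * L)%:R + 1) * e.
pose a := wt (win1 L) * tau^-1.
pose V := wt (win3 L) * (tau^-1 * (2 * rt3 (Q + T))).
have a0 : 0 <= a by rewrite mulr_ge0 ?wt_ge0 // invr_ge0 ltW.
have V0 : 0 <= V by rewrite !mulr_ge0 ?wt_ge0 ?rt3_ge0 // invr_ge0 ltW.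
exists (tau ^+ 3 * (M%:R * (6 * V * a ^+ 2))).
  apply: mulr_ge0; first exact: exprn_ge0 (ltW tau0).
  by rewrite mulr_ge0 // mulr_ge0 ?sqr_ge0 // mulr_ge0.
move=> N q N0 q0; set h := T / N%:R.
have NR : 0 < N%:R :> R by rewrite ltr0n.
have qR : 0 < q%:R :> R by rewrite ltr0n.
have h0 : 0 <= h by rewrite divr_ge0 // ltW.
have hN : N%:R * h = T by rewrite /h mulrC divfK // gt_eqF.
pose x (r : 'I_q) (i : 'I_N) : R := (i%:R + r%:R / q%:R) * h.
have x0 r i : 0 <= x r i by rewrite mulr_ge0 // addr_ge0 // divr_ge0.
have gA r i : gspan (incr h (x r i)) by exact: gspan_incr.
pose v r i (j : 'I_M) := 6 * cov (incr h (x r i)) (tvar e (win3 L) j) * cov (incr h (x r i)) (tvar e (win1 L) j) ^+ 2.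
exists (q%:R^-1 * tau ^+ 3 * \sum_(r < q) \sum_(i < N) \sum_(j < M) v r i j).
  apply: (@eq_has_mean _ _ _ _ (fun w => q%:R^-1 * tau ^+ 3 * \sum_(r < q) \sum_(i < N) \sum_(j < M) (incr h (x r i) w ^+ 3 * test e L j w))) => [w|].
    rewrite /riem /gfun -/h mulrACA; congr (_ * _).
    rewrite mulr_suml; apply: eq_bigr => r _.
    rewrite mulr_suml; apply: eq_bigr => i _.
    by rewrite mulr_sumr.
  apply: has_meanZ; apply: has_mean_sum => r _; apply: has_mean_sum => i _.
  by apply: has_mean_sum => j _; exact: mean_cube_test.
have kap y : `|rt3 (y + h) - rt3 y| <= rt3 h.
  by apply: le_trans (rt3_sub_le _ _) _; rewrite addrAC subrr add0r.
have c1 r i j : `|cov (incr h (x r i)) (tvar e (win1 L) j)| <= a * rt3 h.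
  rewrite cov_tvarr // (le_trans (ler_norm_sum _ _ _)) // /a /wt -mulrA mulr_suml.
  apply: ler_sum => p _; rewrite normrM ler_wpM2l //.
  apply: le_trans (norm_cov_incr_winc _ e0 h0 (x0 r i)) _.
  rewrite -/tau invfM (mulrC 2^-1) -mulrA ler_wpM2l ?invr_ge0 ?(ltW tau0) //.
  have := kap (x r i - (j + p.2)%:R * e); have := kap (x r i - (j + p.2)%:R * e - e); lra.
have c3 r (j : 'I_M) : \sum_(i < N) `|cov (incr h (x r i)) (tvar e (win3 L) j)| <= V.
  apply: (@le_trans _ _ (\sum_(i < N) \sum_(p <- win3 L) `|p.1| * `|cov (incr h (x r i)) (winc e (j + p.2))|)).
    apply: ler_sum => i _; rewrite cov_tvarr // (le_trans (ler_norm_sum _ _ _)) //.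
    by apply: ler_sum => p _; rewrite normrM.
  rewrite exchange_big /= /V /wt mulr_suml big_seq [leRHS]big_seq; apply: ler_sum => p pw.
  have p2 : (p.2 < 2 * L)%N by move: pw => /mapP[k]; rewrite mem_iota add0n => /andP[_ ?] ->.
  rewrite -mulr_sumr ler_wpM2l //.
  apply: le_trans; first by apply: ler_sum => i _; exact: (norm_cov_incr_winc _ e0 h0 (x0 r i)).
  rewrite -mulr_sumr -/tau invfM (mulrC 2^-1) -mulrA ler_wpM2l ?invr_ge0 ?(ltW tau0) // big_split /=.
  pose y := r%:R / q%:R * h - (j + p.2)%:R * e.
  have yE i : x r i - (j + p.2)%:R * e = y + i%:R * h by rewrite /x /y; ring.
  have yE' i : x r i - (j + p.2)%:R * e - e = (y - e) + i%:R * h by rewrite yE; ring.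
  under eq_bigr => i _ do rewrite yE.
  under [X in _ * (_ + X)]eq_bigr => i _ do rewrite yE'.
  have s1 := sum_norm_rt3_sub_le y N h0.
  have s2 := sum_norm_rt3_sub_le (y - e) N h0.
  rewrite hN in s1 s2.
  have rq : 0 <= r%:R / q%:R * h <= T.
    have r0 : 0 <= r%:R / q%:R :> R by rewrite divr_ge0.
    have r1 : r%:R / q%:R <= 1 :> R by rewrite ler_pdivrMr // mul1r ler_nat ltnW.
    have hT : h <= T by rewrite -hN ler_peMl // ler1n.
    rewrite mulr_ge0 //=; apply: le_trans hT.
    by rewrite -[leRHS]mul1r ler_wpM2r.
  have jp : 0 <= (j + p.2)%:R * e <= (M%:R + (2 * L)%:R) * e.
    by rewrite mulr_ge0 ?(ltW e0) //= ler_wpM2r ?(ltW e0) // -natrD ler_nat leq_add // ltnW.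
  have Q0 : 0 <= (M%:R + (2 * L)%:R) * e by rewrite mulr_ge0 ?(ltW e0) // addr_ge0.
  have big z : - Q <= z <= T -> rt3 (z + T) <= rt3 (Q + T) /\ rt3 z <= rt3 (Q + T).
    rewrite /Q => zz; split; apply: ler_rt3; rewrite [leRHS]ger0_norm ?ler_norml; lra.
  have [] := big y; first by rewrite /Q /y; lra.
  have [] := big (y - e); first by rewrite /Q /y; lra.
  lra.
have row r : \sum_(i < N) \sum_(j < M) v r i j <= M%:R * (6 * V * a ^+ 2) * rt3 h ^+ 2.
  rewrite exchange_big /=.
  have -> : M%:R * (6 * V * a ^+ 2) * rt3 h ^+ 2 = \sum_(j < M) (6 * V * a ^+ 2 * rt3 h ^+ 2).
    by rewrite sum_const_ord -mulrA.
  apply: ler_sum => j _.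
  apply: (@le_trans _ _ (\sum_(i < N) `|cov (incr h (x r i)) (tvar e (win3 L) j)| * (6 * (a * rt3 h) ^+ 2))).
    apply: ler_sum => i _; rewrite /v.
    have q1 : cov (incr h (x r i)) (tvar e (win1 L) j) ^+ 2 <= (a * rt3 h) ^+ 2.
      rewrite -real_normK ?num_real // ler_pXn2r ?nnegrE // mulr_ge0 ?rt3_ge0 //.
    rewrite -mulrA mulrCA; apply: (@le_trans _ _ (`|cov (incr h (x r i)) (tvar e (win3 L) j)| * (6 * cov (incr h (x r i)) (tvar e (win1 L) j) ^+ 2))).
      by rewrite ler_wpM2r ?ler_norm // mulr_ge0 // sqr_ge0.
    by rewrite ler_wpM2l // ler_wpM2l.
  rewrite -mulr_suml (_ : 6 * V * _ * _ = V * (6 * (a * rt3 h) ^+ 2)); last by ring.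
  by rewrite ler_wpM2r ?c3 // mulr_ge0 // sqr_ge0.
apply: (@le_trans _ _ (q%:R^-1 * tau ^+ 3 * \sum_(r < q) (M%:R * (6 * V * a ^+ 2) * rt3 h ^+ 2))).
  by rewrite ler_wpM2l ?mulr_ge0 ?invr_ge0 ?exprn_ge0 ?(ltW tau0) //; apply: ler_sum => r _; exact: row.
rewrite sum_const_ord le_eqVlt; apply/orP; left; apply/eqP; field.
by rewrite gt_eqF.
Qed.

End fbm_moments.

(** * Passage to the limit *)

Lemma uniform_continuity_segment (R : realType) (g : R -> R) (a b eta : R) :
  {within `[a, b], continuous g} -> 0 < eta ->
  exists2 r, 0 < r & forall x y, x \in `[a, b] -> y \in `[a, b] ->
    `|x - y| < r -> `|g x - g y| <= eta.
Proof.
move=> cg eta0.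
have /compact_near_coveringP/near_covering_withinP cov := @segment_compact R a b.
pose Q (r x : R) := forall y, y \in `[a, b] -> `|x - y| < r -> `|g x - g y| <= eta.
have H : forall x, `[a, b]%classic x -> \forall x' \near x & i \near (0 : R)^'+, `[a, b]%classic x' -> Q i x'.
  move=> x abx; have eta2 : 0 < eta / 2 by rewrite divr_gt0.
  have /subspace_continuousP/(_ x abx)/cvgrPdist_lt/(_ _ eta2) := cg.
  rewrite near_withinE => -[e /= e0 he].
  have e2 : 0 < e / 2 by rewrite divr_gt0.
  exists (ball x (e / 2), [set r | r < e / 2]).
    split; first exact: nbhsx_ballx.
    exact: nbhs_right_lt.
  move=> [x' r] /= [bx' re] abx' y aby xy.
  have h1 : `|g x - g x'| < eta / 2.
    by apply: he abx'; rewrite /ball /= (lt_trans bx') //; lra.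
  have h2 : `|g x - g y| < eta / 2.
    apply: he aby; rewrite /ball /=.
    have -> : x - y = (x - x') + (x' - y) by ring.
    by apply: le_lt_trans (ler_normD _ _) _; move: bx' xy re; rewrite /ball /=; lra.
  have -> : g x' - g y = (g x - g y) - (g x - g x') by ring.
  by apply: le_trans (ler_normB _ _) _; lra.
have [r /= r0 hr] : \forall i \near (0 : R)^'+, `[a, b]%classic `<=` Q i by apply: cov.
exists (r / 2); first by rewrite divr_gt0.
move=> x y abx aby xy.
have r2 : 0 < r / 2 by rewrite divr_gt0.
apply: (hr (r / 2)) => //=.
by rewrite sub0r normrN gtr0_norm //; lra.
Qed.

Lemma riemann_sum_approx (R : realType) (g : R -> R) (T eta : R) : 0 < T ->
  {within `[0, T], continuous g} -> 0 < eta -> exists n0, forall n, (n0 < n)%N ->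
  `|T / n%:R * \sum_(l < n) g (l%:R * (T / n%:R)) -
     \int[lebesgue_measure]_(x in `[0, T]) g x| <= eta.
Proof.
move=> T0 cg eta0.
have eT : 0 < eta / T by rewrite divr_gt0.
have [r r0 hr] := uniform_continuity_segment cg eT.
exists (Num.truncn (T / r)) => n nn0.
have nT : T / r < n%:R.
  have /andP[_ h] := @truncn_itv R (T / r) (ltW (divr_gt0 T0 r0)).
  by apply: (lt_le_trans h); rewrite ler_nat.
have n0 : 0 < n%:R :> R by apply: lt_trans nT; rewrite divr_gt0.
set h := T / n%:R.
have h0 : 0 < h by rewrite divr_gt0.
have hr' : h < r by rewrite /h ltr_pdivrMr // mulrC -ltr_pdivrMr.
have nh : n%:R * h = T by rewrite /h mulrC divfK // gt_eqF.
have ig : lebesgue_measure.-integrable `[0, T] (EFin \o g).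
  by apply: continuous_compact_integrable => //; exact: segment_compact.
have iT (c : R) : lebesgue_measure.-integrable `[0, T] (EFin \o (fun=> c)).
  apply: continuous_compact_integrable; first exact: segment_compact.
  by apply: continuous_subspaceT => z; exact: cvg_cst.
have igs (a b : R) : 0 <= a -> b <= T -> lebesgue_measure.-integrable `[a, b] (EFin \o g).
  move=> a0 bT; apply: integrableS ig => //; apply: subset_itv; rewrite bnd_simp //.
have step k : (k.+1 <= n)%N ->
    `|h * g (k%:R * h) - \int[lebesgue_measure]_(x in `]k%:R * h, k.+1%:R * h]) g x| <= h * (eta / T).
  move=> kn; set A := `]_, _]%classic.
  have kh0 : 0 <= k%:R * h by rewrite mulr_ge0 // ltW.
  have khT : k.+1%:R * h <= T by rewrite -nh ler_wpM2r ?ler_nat // ltW.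
  have iA : lebesgue_measure.-integrable A (EFin \o g).
    apply: integrableS ig => //; first exact: measurable_itv.
    move=> z; rewrite /A /= !in_itv /= => /andP[z1 z2].
    by rewrite (le_trans kh0 (ltW z1)) (le_trans z2).
  have mA : lebesgue_measure A = h%:E :> \bar R.
    rewrite lebesgue_measure_itv /= lte_fin ltr_pM2r // ltr_nat ltnSn.
    by rewrite -EFinB -mulrBl -natr1 addrAC subrr add0r mul1r.
  have cA c : \int[lebesgue_measure]_(x in A) c = h * c.
    rewrite Rintegral_cst; last exact: measurable_itv.
    by rewrite mulrC; congr (_ * c); exact: (congr1 fine mA).
  have iC c : lebesgue_measure.-integrable A (EFin \o (fun=> c)).
    apply: integrableS (iT c) => //; first exact: measurable_itv.
    move=> z; rewrite /A /= !in_itv /= => /andP[z1 z2].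
    by rewrite (le_trans kh0 (ltW z1)) (le_trans z2).
  have iB : lebesgue_measure.-integrable A (EFin \o (fun t => g (k%:R * h) - g t)).
    by have := integrableB _ (iC (g (k%:R * h))) iA; apply; exact: measurable_itv.
  rewrite -cA.
  rewrite -RintegralB //; last exact: measurable_itv.
  apply: le_trans (le_normr_Rintegral _ _) _ => //; first exact: measurable_itv.
  rewrite -cA.
  apply: le_Rintegral => //; [exact: measurable_itv|exact: integrable_norm iB|].
  move=> x; rewrite /A /= in_itv /= => /andP[x1 x2].
  apply: hr; rewrite ?in_itv /=.
  - by rewrite kh0 /= (le_trans _ khT) // ler_wpM2r ?ler_nat // ltW.
  - by rewrite (le_trans kh0 (ltW x1)) (le_trans x2).
  - rewrite distrC gtr0_norm ?subr_gt0 //; apply: le_lt_trans hr'.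
    by move: x2; rewrite -natr1; lra.
have main k : (k <= n)%N ->
    `|h * \sum_(l < k) g (l%:R * h) - \int[lebesgue_measure]_(x in `[0, k%:R * h]) g x| <= k%:R * (h * (eta / T)).
  elim: k => [|k ih] kn.
    by rewrite big_ord0 !mul0r mulr0 set_itv1 Rintegral_set1 subrr normr0.
  have kh0 : 0 <= k%:R * h by rewrite mulr_ge0 // ltW.
  have khk : k%:R * h <= k.+1%:R * h by rewrite ler_wpM2r ?ler_nat // ltW.
  have khT : k.+1%:R * h <= T by rewrite -nh ler_wpM2r ?ler_nat // ltW.
  have E : \int[lebesgue_measure]_(x in `[0, k.+1%:R * h]) g x = \int[lebesgue_measure]_(x in `[0, k%:R * h]) g x +
      \int[lebesgue_measure]_(x in `]k%:R * h, k.+1%:R * h]) g x.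
    rewrite -(@Rintegral_itvB _ g (BLeft 0) (BRight (k.+1%:R * h)) (k%:R * h)) ?bnd_simp //.
      by rewrite addrC subrK.
    exact: igs.
  rewrite big_ord_recr /= mulrDr E opprD addrACA.
  apply: le_trans (ler_normD _ _) _.
  rewrite -[in leRHS]natr1 mulrDl mul1r lerD ?step //.
  exact: ih (ltnW kn).
have := main n (leqnn n); rewrite nh => /le_trans; apply.
by rewrite mulrA nh mulrC divfK // gt_eqF.
Qed.

Lemma sum_blocks (R : nmodType) (N q : nat) (F : nat -> R) :
  \sum_(l < N * q) F l = \sum_(r < q) \sum_(i < N) F (i * q + r)%N.
Proof.
rewrite exchange_big /=.
elim: N => [|N ih]; first by rewrite mul0n !big_ord0.
rewrite mulSnr big_split_ord big_ord_recr /= ih; congr (_ + _).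
Qed.

Section riemann_limit.
Context d (Omega : measurableType d) (R : realType) (P : probability Omega R).
Variable X : R -> {RV P >-> R}.
Hypothesis cX : forall w : Omega, {within `[0, +oo[, continuous (fun t : R => X t w)}.

Lemma riem_cvg N T w : (0 < N)%N -> 0 < T ->
  riem X N q.+1 T w @[q --> \oo] --> cubic_variation X T (T / N%:R) w.
Proof.
move=> N0 T0; set e := T / N%:R.
have cXw : {within `[0, +oo[, continuous (fun t : R => X t w)} by exact: cX.
have NR : 0 < N%:R :> R by rewrite ltr0n.
have e0 : 0 < e by rewrite divr_gt0.
pose g s := (X (s + e) w - X s w) ^+ 3.
have cpath : {within `[0, T], continuous (fun s => X s w)}.
  apply: continuous_subspaceW; last exact: cX.
  by move=> s /=; rewrite !in_itv /= andbT => /andP[].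
have cg : {within `[0, T], continuous g}.
  apply/subspace_continuousP => s sT.
  have s0 : `[0, +oo[%classic s by move: sT; rewrite /= !in_itv /= andbT => /andP[].
  have se0 : `[0, +oo[%classic (s + e).
    by move: s0; rewrite /= !in_itv /= !andbT => s0; rewrite addr_ge0 // ltW.
  have c1 : X s' w @[s' --> within `[0, T]%classic (nbhs s)] --> X s w.
    by have /subspace_continuousP := cpath; apply.
  have c2 : X (s' + e) w @[s' --> within `[0, T]%classic (nbhs s)] --> X (s + e) w.
    have /subspace_continuousP/(_ _ se0)/cvgrPdist_lt h := cXw.
    apply/cvgrPdist_lt => eta eta0; move: (h eta eta0); rewrite !near_withinE => -[r /= r0 hr].
    exists r => //= s' ss' s'T; apply: hr.
      by rewrite /ball /= opprD addrACA subrr addr0.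
    by move: s'T; rewrite /= !in_itv /= andbT => /andP[h1 _]; rewrite addr_ge0 // ltW.
  exact: (cvgM (cvgB c2 c1) (cvgM (cvgB c2 c1) (cvgB c2 c1))).
apply/cvgrPdist_le => eta eta0.
(* The integral is divided by e in the cubic variation, so it is approximated within eta e. *)
have ee : 0 < eta * e by rewrite mulr_gt0.
have [n0 hn] := riemann_sum_approx T0 cg ee.
exists n0 => // q /= nq.
have nNq : (n0 < N * q.+1)%N by rewrite (leq_ltn_trans nq) // (leq_trans (ltnSn q)) // leq_pmull.
have := hn _ nNq; rewrite distrC /cubic_variation /riem -/e.
have qR : 0 < q.+1%:R :> R by rewrite ltr0n.
have -> : T / (N * q.+1)%:R * \sum_(l < N * q.+1) g (l%:R * (T / (N * q.+1)%:R)) =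
   e * (q.+1%:R^-1 * \sum_(r < q.+1) \sum_(i < N) incr X e ((i%:R + r%:R / q.+1%:R) * e) w ^+ 3).
  rewrite (sum_blocks _ _ (fun l => g (l%:R * (T / (N * q.+1)%:R)))) mulrA; congr (_ * _).
    by rewrite /e natrM invfM mulrA.
  apply: eq_bigr => r _; apply: eq_bigr => i _; rewrite /incr /g.
  suff -> : (i * q.+1 + r)%:R * (T / (N * q.+1)%:R) = (i%:R + r%:R / q.+1%:R) * e by [].
  by rewrite /e natrD !natrM; field; rewrite !gt_eqF.
rewrite -/(g _); set I := \int[_]_(x in _) _; set S := q.+1%:R^-1 * _.
have -> : I - e * S = e * (e^-1 * I - S) by field; rewrite gt_eqF.
by rewrite normrM gtr0_norm // mulrC ler_pM2r.
Qed.

Lemma measurable_riem N q T : measurable_fun setT (riem X N q T).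
Proof.
apply: measurable_funM => //; apply: measurable_sum => r; apply: measurable_sum => i.
by apply: measurable_funX; exact: measurable_funB.
Qed.

(** Measurability in w of the path integral is inherited from the Riemann sums, which converge to it
    along every path. *)
Lemma measurable_cubic_variation N T : (0 < N)%N -> 0 < T ->
  measurable_fun setT (cubic_variation X T (T / N%:R)).
Proof.
move=> N0 T0; apply: (measurable_fun_cvg (fun q => measurable_riem N q.+1 T)) => w _.
exact: riem_cvg.
Qed.

Lemma measurable_ge_norm (f : Omega -> R) (a : R) : measurable_fun setT f ->
  measurable [set w | a <= `|f w|].
Proof.
move=> mf; have mn : measurable_fun setT (fun w => `|f w|) by apply: measurableT_comp.
rewrite -[X in measurable X]setTI.
have -> : [set w | a <= `|f w|] = (fun w => `|f w|) @^-1` `[a, +oo[.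
  by apply/seteqP; split => w /=; rewrite in_itv /= andbT.
exact: mn.
Qed.

(** At each point the indicators of the deviation events are eventually 0, and they are dominated by
    1. *)
Lemma cvg_prob_pointwise (f_ : nat -> Omega -> R) (f : Omega -> R) (a : R) : 0 < a ->
  (forall n, measurable_fun setT (f_ n)) -> measurable_fun setT f ->
  (forall w, f_ n w @[n --> \oo] --> f w) ->
  P [set w | a <= `|f_ n w - f w|] @[n --> \oo] --> 0%E.
Proof.
move=> a0 mf_ mf ff.
pose A n := [set w | a <= `|f_ n w - f w|].
have mA n : measurable (A n) by apply: measurable_ge_norm; exact: measurable_funB.
have [] := @dominated_convergence _ _ _ P setT measurableT (fun n w => (\1_(A n) w)%:E) (cst 0%E) (cst 1%E).
- by move=> n; apply/measurable_EFinP; exact: measurable_indic.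
- by [].
- apply: aeW => w _; apply: cvg_near_cst.
  have /cvgrPdist_lt/(_ _ a0) := ff w; apply: filterS => n h.
  rewrite indicE memNset //= => h2; move: h; rewrite distrC ltNge => /negP; exact.
- exact: finite_measure_integrable_cst.
- apply: aeW => w n _; rewrite /= lee_fin indicE.
  by case: (w \in A n); rewrite ?normr1 ?normr0.
move=> _ _; rewrite integral_cst // mul0e.
by under eq_fun do rewrite integral_indic // setIT.
Qed.

End riemann_limit.

(** Off the event |D| >= eta, D G is at most eta (1 + G^4); on it, Young's inequality leaves small
    multiples of D^2 and G^4 plus a constant, which the probability of the event multiplies. Both
    [eta] and [p0] depend on c, A, C only, so they can be fixed before the scales. *)
Lemma anticoncentration d (Omega : measurableType d) (R : realType) (P : probability Omega R) (c A C : R) :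
  0 < c -> 0 < A -> 0 < C -> exists eta p0 : R, [/\ 0 < eta, 0 < p0 &
  forall (D G S U : Omega -> R) (v a u : R), measurable_fun setT D ->
    has_mean P (fun w => D w * G w) v -> c <= v ->
    has_mean P S a -> a <= A -> (forall w, D w ^+ 2 <= S w) ->
    has_mean P U u -> u <= C -> (forall w, G w ^+ 4 <= U w) ->
    (p0%:E <= P [set w | (eta <= `|D w|)%R])%E].
Proof.
move=> c0 A0 C0.
(* These choices make each of eta (1 + C), th A and ka C / (4 th) equal to c / 8. The remaining 5 c
   / 8 is at most P(B) / (16 ka th), whence p0 = 10 c ka th. *)
pose th := c / (8 * A); pose ka := th * c / (2 * C); pose eta := c / (8 * (1 + C)).
have th0 : 0 < th by rewrite divr_gt0 // mulr_gt0.
have ka0 : 0 < ka by apply: divr_gt0; exact: mulr_gt0.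
have kt0 : 0 < 16 * ka * th by rewrite -mulrA; apply: mulr_gt0 => //; exact: mulr_gt0.
have kt : 0 <= ka / (4 * th) by apply: divr_ge0; [exact: ltW|apply: mulr_ge0 => //; exact: ltW].
have eta0 : 0 < eta by rewrite divr_gt0 // mulr_gt0 // addr_gt0.
exists eta, (10 * c * (ka * th)); split=> //.
  by apply: mulr_gt0; exact: mulr_gt0.
move=> D G S U v a u mD mDG cv mS aA DS mU uC GU.
set B := [set w | _].
have mB : measurable B by exact: measurable_ge_norm.
have mI := has_mean_indic P mB.
have m := has_meanD (has_meanD (has_meanZ eta (has_meanD (has_mean_cst P 1) mU)) (has_meanZ th mS))
  (has_meanD (has_meanZ (ka / (4 * th)) mU) (has_meanZ (16 * ka * th)^-1 mI)).
have pB : (fine (P B))%:E = P B by rewrite fineK // fin_num_measure.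
rewrite -pB lee_fin.
have key : v <= eta * (1 + u) + th * a + (ka / (4 * th) * u + (16 * ka * th)^-1 * fine (P B)).
  apply: ler_has_mean mDG m _ => w.
  have U0 : 0 <= U w by apply: le_trans (GU w); rewrite (_ : 4 = 2 * 2)%N // exprM sqr_ge0.
  have S0 : 0 <= S w by apply: le_trans (DS w); exact: sqr_ge0.
  have kU : 0 <= ka / (4 * th) * U w by exact: mulr_ge0.
  have tS : 0 <= th * S w by apply: mulr_ge0 => //; exact: ltW.
  have [Bw|Bw] := pselect (B w); last first.
    rewrite indicE memNset // mulr0 addr0.
    have D1 : `|D w| <= eta by move: Bw => /negP; rewrite -ltNge => /ltW.
    have G1 : `|G w| <= 1 + U w.
      apply: le_trans (_ : 1 + G w ^+ 4 <= _); last by rewrite lerD2l.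
      have : 0 <= (`|G w| ^+ 2 - 1) ^+ 2 by exact: sqr_ge0.
      have -> : G w ^+ 4 = `|G w| ^+ 4 by rewrite -normrX ger0_norm // (_ : 4 = 2 * 2)%N // exprM sqr_ge0.
      have := normr_ge0 (G w); move: `|G w| => x x0; nra.
    have : D w * G w <= eta * (1 + U w).
      apply: le_trans (ler_norm _) _; rewrite normrM; exact: ler_pM.
    lra.
  rewrite indicE mem_set // mulr1.
  have e1 : 0 <= eta * (1 + U w) by apply: mulr_ge0; [exact: ltW|exact: addr_ge0].
  (* Young's inequality, first for D G and then for G ^ 2 on the event B. *)
  have h1 : D w * G w <= th * D w ^+ 2 + G w ^+ 2 / (4 * th).
    have -> : th * D w ^+ 2 + G w ^+ 2 / (4 * th) = D w * G w + th * (D w - G w / (2 * th)) ^+ 2.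
      by field; rewrite gt_eqF.
    by rewrite lerDl; apply: mulr_ge0; [exact: ltW|exact: sqr_ge0].
  have h2 : G w ^+ 2 / (4 * th) <= ka / (4 * th) * G w ^+ 4 + (16 * ka * th)^-1.
    have -> : ka / (4 * th) * G w ^+ 4 + (16 * ka * th)^-1 = G w ^+ 2 / (4 * th) + ka / (4 * th) * (G w ^+ 2 - (2 * ka)^-1) ^+ 2.
      by field; rewrite !gt_eqF.
    by rewrite lerDl; apply: mulr_ge0 => //; exact: sqr_ge0.
  have h3 : th * D w ^+ 2 <= th * S w by apply: ler_wpM2l => //; exact: ltW.
  have h4 : ka / (4 * th) * G w ^+ 4 <= ka / (4 * th) * U w.
    exact: ler_wpM2l.
  lra.
have b1 : eta * (1 + u) <= c / 8.
  have -> : c / 8 = eta * (1 + C) by rewrite /eta; field; rewrite gt_eqF // addr_gt0.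
  by apply: ler_wpM2l; [exact: ltW|rewrite lerD2l].
have b2 : th * a <= c / 8.
  have -> : c / 8 = th * A by rewrite /th; field; rewrite gt_eqF.
  by apply: ler_wpM2l => //; exact: ltW.
have b3 : ka / (4 * th) * u <= c / 8.
  have -> : c / 8 = ka / (4 * th) * C by rewrite /ka; field; rewrite !gt_eqF.
  exact: ler_wpM2l.
have : 5 / 8 * c <= (16 * ka * th)^-1 * fine (P B) by lra.
rewrite [X in _ <= X -> _]mulrC ler_pdivlMr //; apply: le_trans.
by rewrite le_eqVlt; apply/orP; left; apply/eqP; field.
Qed.

Lemma cvge_lt (T : Type) (R : realType) (F : set_system T) (f : T -> \bar R) (a b : \bar R) :
  f @ F --> a -> (a < b)%E -> \forall x \near F, (f x < b)%E.
Proof. by move=> fa ab; apply: (fa [set y | (y < b)%E]); exact: open_ereal_lt'. Qed.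

(** * Incompatibility of the bounds with convergence *)

Section no_limit.
Context d (Omega : measurableType d) (R : realType) (P : probability Omega R).
Variable X : R -> {RV P >-> R}.
Hypothesis hX : fractional_brownian_motion (1 / 6) X.

(** A common consequence of both modes of convergence, restricted to the scales T / N at which
    Riemann sums are available. *)
Definition cvg_probability_steps (T : R) (Y : Omega -> R) : Prop :=
  forall delta p : R, 0 < delta -> 0 < p -> exists2 r : R, 0 < r &
    forall N, (0 < N)%N -> T / N%:R < r ->
    (P [set w | (delta <= `|cubic_variation X T (T / N%:R) w - Y w|)%R] < p%:E)%E.

Lemma exists_step (T r : R) : 0 < T -> 0 < r -> exists N0, forall N, (N0 < N)%N -> T / N%:R < r.
Proof.
move=> T0 r0; exists (Num.truncn (T / r)) => N hN.
have /andP[_ h] := @truncn_itv R (T / r) (ltW (divr_gt0 T0 r0)).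
have nT : T / r < N%:R by apply: (lt_le_trans h); rewrite ler_nat.
have N0 : 0 < N%:R :> R by apply: lt_trans nT; rewrite divr_gt0.
by rewrite ltr_pdivrMr // mulrC -ltr_pdivrMr.
Qed.

Lemma exists_riem_close N T delta p : (0 < N)%N -> 0 < T -> 0 < delta -> 0 < p ->
  exists2 q, (0 < q)%N &
   (P [set w | (delta <= `|riem X N q T w - cubic_variation X T (T / N%:R) w|)%R] < p%:E)%E.
Proof.
move=> N0 T0 d0 p0.
have h := cvg_prob_pointwise P d0 (fun q => measurable_riem X N q.+1 T)
  (measurable_cubic_variation (fbm_continuous hX) N0 T0) (fun w => riem_cvg (fbm_continuous hX) N0 T0).
have lt0 : (0 < p%:E :> \bar R)%E by rewrite lte_fin.
have [n _ hn] := cvge_lt h lt0.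
by exists n.+1 => //; exact: hn n (leqnn n).
Qed.

(** The order of choices matters: [eta] and [p0] fix the required closeness, hence M; the constant
    [C1] depends on e and M, so the finer scale N' comes after them; the meshes q and q' come
    last. *)
Lemma no_cvg_probability_steps T (Y : {RV P >-> R}) : 0 < T -> ~ cvg_probability_steps T Y.
Proof.
move=> T0 hY.
have [L [theta [th0 hlow]]] := mean_riem_gfun_ge hX.
have [C0 C00 h4] := mean_gfun_pow4 hX L.
(* Half of theta T is given up for the correlation with the finer scale. Then 180 = 2 * 45 + 2 * 45
   bounds the mean of D^2 over T, and e M = T / 2 enters C. *)
pose c := theta * T / 2; have c0 : 0 < c by rewrite divr_gt0 // mulr_gt0.
pose A := 180 * T; have A0 : 0 < A by rewrite mulr_gt0.
pose C := C0 * (T / 2) ^+ 2 + 1.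
have CC : 0 < C by rewrite ltr_wpDl // mulr_ge0 // sqr_ge0.
have [eta [p0 [eta0 p00 hanti]]] := anticoncentration P c0 A0 CC.
have e4 : 0 < eta / 4 by rewrite divr_gt0.
have p4 : 0 < p0 / 4 by rewrite divr_gt0.
have [r r0 hr] := hY (eta / 4) (p0 / 4) e4 p4.
have [N1 hN1] := exists_step T0 r0.
pose M := (N1 + L).+1.
have M0 : (0 < M)%N by [].
have LM : (L <= M)%N by rewrite /M -addnS -addSnnS leq_addl.
have NM : (N1 < 2 * M)%N by rewrite mul2n -addnn ltn_addr // ltnS leq_addr.
have N20 : (0 < 2 * M)%N by rewrite muln_gt0.
have MR : 0 < (2 * M)%:R :> R by rewrite ltr0n.
set e := T / (2 * M)%:R.
have e0 : 0 < e by rewrite divr_gt0.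
have [C1 C10 hsmall] := mean_riem_gfun_small hX L M e0 T0.
(* From 0 <= z <= y <= 1 follows z^2 <= y, and y <= c / (C1 + 1) then gives C1 z^2 <= c. *)
pose y := Num.min 1 (c / (C1 + 1)).
have C11 : 0 < C1 + 1 by rewrite ltr_wpDl.
have y0 : 0 < y by rewrite lt_min ltr01 divr_gt0.
have [N2 hN2] := exists_step T0 (exprn_gt0 3 y0).
pose N' := (N1 + N2).+1.
have N'0 : (0 < N')%N by [].
have hN'1 : T / N'%:R < r by apply: hN1; rewrite /N' ltnS leq_addr.
have hN'2 : T / N'%:R < y ^+ 3 by apply: hN2; rewrite /N' ltnS leq_addl.
have rty : rt3 (T / N'%:R) <= y.
  by apply: rt3_ler; [exact: ltW|rewrite gtr0_norm ?divr_gt0 ?ltr0n // ltW].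
have smallc : C1 * rt3 (T / N'%:R) ^+ 2 <= c.
  have y1 : y <= 1 by rewrite ge_min lexx.
  have y2 : y <= c / (C1 + 1) by rewrite ge_min lexx orbT.
  have := rt3_ge0 (T / N'%:R); move: rty y2; rewrite ler_pdivlMr //.
  move: (rt3 _) => z zy y2 z0.
  have : z ^+ 2 <= y by nra.
  nra.
have [q q0 hq] := exists_riem_close N20 T0 e4 p4.
have [q' q'0 hq'] := exists_riem_close N'0 T0 e4 p4.
have [v mv lv] := hlow T T0 M q LM M0 q0.
have [v' mv' lv'] := hsmall N' q' N'0 q'0.
have [a ma la] := mean_riem_sq hX N20 q0 T0.
have [a' ma' la'] := mean_riem_sq hX N'0 q'0 T0.
have [U [u [mU lu hU]]] := h4 e M e0 M0.
pose D w := riem X (2 * M) q T w - riem X N' q' T w.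
have mD : measurable_fun setT D by apply: measurable_funB; exact: measurable_riem.
have mDG : has_mean P (fun w => D w * gfun X e L M w) (v - v').
  by apply: eq_has_mean (has_meanB mv mv') => w; rewrite mulrBl.
have cv : c <= v - v' by move: lv lv' smallc; rewrite /c; lra.
have mS := has_meanD (has_meanZ 2 ma) (has_meanZ 2 ma').
have lS : 2 * a + 2 * a' <= A by rewrite /A; lra.
have DS w : D w ^+ 2 <= 2 * riem X (2 * M) q T w ^+ 2 + 2 * riem X N' q' T w ^+ 2.
  have := sqr_ge0 (riem X (2 * M) q T w + riem X N' q' T w); rewrite /D; lra.
have uC : u <= C.
  apply: (le_trans lu); rewrite /C (_ : e * M%:R = T / 2) ?lerDl //.
  by rewrite /e natrM; field; rewrite pnatr_eq0.
have := hanti _ _ _ _ _ _ _ mD mDG cv mS lS DS mU uC hU.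
apply/negP; rewrite -ltNge.
(* D is a signed sum of four differences through Z_e, Y and Z_h. If |D| >= eta, one of them is at
   least eta / 4, and each such event has probability below p0 / 4. *)
pose B1 := [set w | eta / 4 <= `|riem X (2 * M) q T w - cubic_variation X T e w|].
pose B2 := [set w | eta / 4 <= `|cubic_variation X T e w - Y w|].
pose B3 := [set w | eta / 4 <= `|cubic_variation X T (T / N'%:R) w - Y w|].
pose B4 := [set w | eta / 4 <= `|riem X N' q' T w - cubic_variation X T (T / N'%:R) w|].
have mZ N : (0 < N)%N -> measurable_fun setT (cubic_variation X T (T / N%:R)).
  by move=> Np; have := measurable_cubic_variation (fbm_continuous hX) Np T0; apply.
have mB1 : measurable B1 by apply: measurable_ge_norm; apply: measurable_funB; [exact: measurable_riem|exact: mZ].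
have mB2 : measurable B2 by apply: measurable_ge_norm; apply: measurable_funB => //; exact: mZ.
have mB3 : measurable B3 by apply: measurable_ge_norm; apply: measurable_funB => //; exact: mZ.
have mB4 : measurable B4 by apply: measurable_ge_norm; apply: measurable_funB; [exact: measurable_riem|exact: mZ].
have sub : [set w | eta <= `|D w|] `<=` (B1 `|` B2) `|` (B3 `|` B4).
  move=> w /= Dw; apply: contrapT => /not_orP[/not_orP[n1 n2] /not_orP[n3 n4]].
  move: n1 n2 n3 n4; rewrite /B1 /B2 /B3 /B4 /= => /negP + /negP + /negP + /negP.
  rewrite -!ltNge => n1 n2 n3 n4; move: Dw; apply/negP; rewrite -ltNge /D.
  move: n1 n2 n3 n4; set r1 := riem _ _ _ _ _; set r2 := riem _ _ _ _ _.
  set z1 := cubic_variation _ _ _ _; set z2 := cubic_variation _ _ _ _.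
  rewrite !ltr_norml; lra.
have h12 : (P (B1 `|` B2) <= P B1 + P B2)%E by exact: measureU2.
have h34 : (P (B3 `|` B4) <= P B3 + P B4)%E by exact: measureU2.
have hU4 : (P ((B1 `|` B2) `|` (B3 `|` B4)) <= P (B1 `|` B2) + P (B3 `|` B4))%E.
  by apply: measureU2; exact: measurableU.
have hD : (P [set w | (eta <= `|D w|)%R] <= P ((B1 `|` B2) `|` (B3 `|` B4)))%E.
  apply: le_measure sub; rewrite inE; first exact: measurable_ge_norm.
  by do !apply: measurableU.
apply: (le_lt_trans hD); apply: (le_lt_trans hU4).
apply: (le_lt_trans (leeD h12 h34)).
have -> : p0%:E = ((p0 / 4)%:E + (p0 / 4)%:E + ((p0 / 4)%:E + (p0 / 4)%:E) :> \bar R)%E.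
  by rewrite -!EFinD; congr EFin; field.
have h1 := lteD hq (hr _ N20 (hN1 _ NM)).
have h2 := lteD (hr _ N'0 hN'1) hq'.
exact: lteD h1 h2.
Qed.

Lemma cvg_probability_at0_steps T (Y : Omega -> R) : 0 < T ->
  cvg_probability_at0 P (cubic_variation X T) Y -> cvg_probability_steps T Y.
Proof.
move=> T0 h delta p delta0 p0.
have lt0 : (0 < p%:E :> \bar R)%E by rewrite lte_fin.
have [r /= r0 hr] := cvge_lt (h delta delta0) lt0.
exists r => // N N0 Nr; have TN : 0 < T / N%:R by rewrite divr_gt0 // ltr0n.
by apply: hr => //=; rewrite sub0r normrN gtr0_norm.
Qed.

Lemma cvg_L2_at0_steps T (Y : {RV P >-> R}) : 0 < T ->
  cvg_L2_at0 P (cubic_variation X T) Y -> cvg_probability_steps T Y.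
Proof.
move=> T0 h delta p delta0 p0.
(* Chosen so that Chebyshev's bound b^2 / delta^2 equals p. *)
pose b := delta * Num.sqrt p.
have b0 : 0 < b by rewrite mulr_gt0 // sqrtr_gt0.
have lt0 : (0 < b%:E :> \bar R)%E by rewrite lte_fin.
have [r /= r0 hr] := cvge_lt h lt0.
exists r => // N N0 Nr; have TN : 0 < T / N%:R by rewrite divr_gt0 // ltr0n.
have mZ := measurable_cubic_variation (fbm_continuous hX) N0 T0.
pose f w := cubic_variation X T (T / N%:R) w - Y w.
have mf : measurable_fun setT f by exact: measurable_funB.
have Nf : ('N[P]_2%:E [EFin \o f] < b%:E)%E.
  by apply: hr => //=; rewrite sub0r normrN gtr0_norm.
have I0 : (0 <= \int[P]_w ((f w) ^+ 2)%:E)%E.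
  by apply: integral_ge0 => w _; rewrite lee_fin sqr_ge0.
have If : (\int[P]_w ((f w) ^+ 2)%:E < (b ^+ 2)%:E)%E.
  have := @poweR_Lnorm _ _ _ P (EFin \o f) 2.
  rewrite pnatr_eq0 => /(_ isT) e.
  have -> : (\int[P]_w ((f w) ^+ 2)%:E = \int[P]_w `|(EFin \o f) w| `^ 2)%E.
    apply: eq_integral => w _ /=.
    by rewrite powR_mulrn // real_normK // num_real.
  rewrite -e; move: Nf (Lnorm_ge0 P 2%:E (EFin \o f)).
  case: ('N[P]_2%:E [EFin \o f])%E => [x| |] //=.
  rewrite lte_fin lee_fin => xb x0.
  by rewrite powR_mulrn // lte_fin ltr_pXn2r // nnegrE ltW.
set B := [set w | _].
have mB : measurable B by exact: measurable_ge_norm.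
have hB : ((delta ^+ 2)%:E * P B <= \int[P]_w ((f w) ^+ 2)%:E)%E.
  rewrite -[X in (_ * P X)%E]setIT -integral_indic // -ge0_integralZl //=.
  - apply: ge0_le_integral => //=.
    + by move=> w _; rewrite -EFinM lee_fin mulr_ge0 // sqr_ge0.
    + apply/measurable_EFinP; apply: measurable_funM => //; exact: measurable_indic.
    + by apply/measurable_EFinP; exact: measurable_funX.
    + move=> w _; rewrite -EFinM lee_fin indicE.
      case: (boolP (w \in B)) => [|_]; last by rewrite mulr0 sqr_ge0.
      rewrite inE /B /= => hw; rewrite mulr1 -[leRHS]real_normK ?num_real //.
      by rewrite ler_pXn2r // nnegrE ltW.
  - by apply/measurable_EFinP; exact: measurable_indic.
  - by rewrite lee_fin sqr_ge0.
have := le_lt_trans hB If.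
have -> : P B = (fine (P B))%:E by rewrite fineK // fin_num_measure.
rewrite -EFinM !lte_fin /b exprMn sqr_sqrtr ?(ltW p0) // ltr_pM2l // exprn_gt0 //.
Qed.

End no_limit.

Theorem proposition2 (d : measure_display) (Omega : measurableType d)
    (R : realType) (P : probability Omega R) (X : R -> {RV P >-> R})
    (hX : fractional_brownian_motion (1 / 6) X) (T : R) (hT : 0 < T) :
  (~ exists Y : {RV P >-> R}, (Y : Omega -> R) \in Lfun P 2%:E /\
       cvg_L2_at0 P (cubic_variation X T) Y) /\
  (~ exists Y : {RV P >-> R},
       cvg_probability_at0 P (cubic_variation X T) Y).
Proof.
split=> [[Y [_ h]]|[Y h]]; apply: (@no_cvg_probability_steps _ _ _ _ _ hX T Y hT).
  exact: cvg_L2_at0_steps hX T Y hT h.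
exact: cvg_probability_at0_steps hT h.
Qed.
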